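(* Let $(u_n)_{n \geq 0}$ be a sequence of integers, not identically zero, satisfying $u_n = a_1 u_{n-1} + a_2 u_{n-2} + \cdots + a_k u_{n-k}$ for all integers $n \geq k$, where $k \geq 1$, $a_1, \ldots, a_k \in \mathbf{Z}$ and $a_k \neq 0$. Assume $(u_n)_{n \geq 0}$ is nondegenerate. Let $\mathcal{A}_u = \{n \in \mathbf{N} : \gcd(n, u_n) = 1\}$. Then the asymptotic density $\mathbf{d}(\mathcal{A}_u)$ exists. Moreover, if $(u_n/n)_{n \geq 1}$ is not a linear recurrence, then $\mathbf{d}(\mathcal{A}_u) > 0$; otherwise, $\mathcal{A}_u$ is finite (and so $\mathbf{d}(\mathcal{A}_u) = 0$).
   Context: $\mathbf{N}$ denotes the set of positive integers. The linear recurrence is nondegenerate if no ratio $\alpha_i/\alpha_j$ of two distinct roots of its characteristic polynomial $X^k - a_1X^{k-1} - \cdots - a_k$ is a root of unity. A sequence is a linear recurrence if it satisfies a linear recurrence relation of finite order with constant (complex) coefficients. For $\mathcal{S} \subseteq \mathbf{N}$, the asymptotic density $\mathbf{d}(\mathcal{S})$ is $\lim_{x \to +\infty} \#(\mathcal{S} \cap [1,x])/x$ when this limit exists. *)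

(* Defs.v *)
From mathcomp Require Import all_boot all_order all_algebra complex.
From mathcomp Require Import all_classical all_reals all_analysis.
Set Implicit Arguments. Unset Strict Implicit. Unset Printing Implicit Defensive.
Import Order.TTheory GRing.Theory Num.Theory numFieldNormedType.Exports.
Local Open Scope ring_scope.
Local Open Scope classical_set_scope.

Definition int_lin_rec (u : nat -> int) (k : nat) (a : nat -> int) : Prop :=
  forall n : nat, (k <= n)%N -> u n = \sum_(1 <= i < k.+1) a i * u (n - i)%N.

Definition char_poly (C : nzRingType) (k : nat) (a : nat -> int) : {poly C} :=
  'X^k - \sum_(1 <= i < k.+1) (a i)%:~R *: 'X^(k - i).

Definition nondegenerate_lrs (C : fieldType) (k : nat) (a : nat -> int) : Prop :=
  forall alpha beta : C, root (char_poly C k a) alpha -> root (char_poly C k a) beta ->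
    alpha != beta -> forall m : nat, (0 < m)%N -> (alpha / beta) ^+ m != 1.

Definition is_linear_recurrence (C : nzRingType) (v : nat -> C) : Prop :=
  exists (m : nat) (c : nat -> C), forall n : nat,
    v (n + m)%N = \sum_(1 <= i < m.+1) c i * v (n + m - i)%N.

Definition has_density (R : realType) (S : pred nat) (d : R) : Prop :=
  (fun x : R => (count S (iota 1 (Num.truncn x)))%:R / x) @ +oo%R --> d.

(* Main.v *)
(** Idea. Write [u_n = sum_i alpha_i^n f_i(n)] with distinct roots [alpha_i] and [f_i] a
    combination of the binomials [C(n, j)], [j < k]. For a large prime [p] all [C(pm, j)] with
    [0 < j < k] vanish modulo [p], so [u_{pm} = sum_i f_i(0) alpha_i^{pm}] modulo [p]. If every
    [f_i(0)] is zero then [u_n / n] is itself a linear recurrence. It is then also annihilated by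
    a monic integer polynomial, hence has bounded denominators, so that [n | D u_n] for a fixed
    [D], and [gcd(n, u_n) = 1] forces [n | D].

    Otherwise the zeros [m] modulo [p] of [sum_i b_i gamma_i^m] are sparse: among many zeros in
    an interval of length [L], many pairs [m, m + d] share one [d < L], and combining the two
    relations removes one term at the cost of the factors [gamma_i^d - gamma_r^d]. These factors
    are regular modulo [p] unless [p] divides some nonzero integer multiple of
    [alpha_i^d - alpha_j^d], which only [O(L^2)] primes do over all [d < L]. By induction on the
    number of terms there are [O(L^(1 - 1/e))] zeros, [e = 2^r].

    Taking [L] to be a small power of [p], the integers [n] with a common prime factor [p >= Y]
    of [n] and [u_n] have upper density [O(Y^(-c))]. The conditions at the primes [p < Y] are
    eventually periodic in [n], hence the density exists. It is positive because the integers
    free of prime factors below [Y] have density at least [Y^(-c')] for any [c' > 0]. *)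

From HB Require Import structures.
Require Import Defs.
From mathcomp Require Import all_boot all_order all_fingroup all_algebra complex.
From mathcomp Require Import all_classical all_reals all_analysis.
From mathcomp Require Import ring lra zify.
Set Implicit Arguments. Unset Strict Implicit. Unset Printing Implicit Defensive.
Import Order.TTheory GRing.Theory Num.Theory.
Import numFieldNormedType.Exports.

(** * Prime numbers *)

Lemma leq_exp_base m n e : m <= n -> m ^ e <= n ^ e.
Proof. by case: e => // e mn; rewrite leq_exp2r. Qed.

Lemma prod_primes_dvd (s : seq nat) m :
  uniq s -> (forall p, p \in s -> prime p && (p %| m)) -> \prod_(p <- s) p %| m.
Proof.
elim: s => [|p s IH] /=; first by rewrite big_nil dvd1n.
move=> /andP[ps us] h; rewrite big_cons Gauss_dvd.
  have /andP[_ ->] := h p (mem_head _ _).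
  by apply: IH => // q qs; apply: h; rewrite inE qs orbT.
have /andP[p_pr _] := h p (mem_head _ _).
rewrite big_seq; apply: (big_ind (fun x => coprime p x)).
- exact: coprimen1.
- by move=> x y hx hy; rewrite coprimeMr hx.
move=> q qs; have /andP[q_pr _] : prime q && (q %| m) by apply: h; rewrite inE qs orbT.
rewrite prime_coprime // dvdn_prime2 //.
by apply: contraNneq ps => ->.
Qed.

Lemma prod_primes_cond_dvd (P : pred nat) a b m :
  (forall p, P p -> prime p && (p %| m)) -> \prod_(a <= p < b | P p) p %| m.
Proof.
move=> h; rewrite -big_filter; apply: prod_primes_dvd.
  by rewrite filter_uniq // iota_uniq.
by move=> p; rewrite mem_filter => /andP[/h].
Qed.

Lemma count_multiples p N : 0 < p -> \sum_(1 <= m < N.+1 | p %| m) 1 = N %/ p.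
Proof.
move=> p0; elim: N => [|N IH]; first by rewrite big_geq // div0n.
rewrite big_mkcond big_nat_recr //= -big_mkcond IH.
by rewrite divnS // addnC; case: (p %| N.+1).
Qed.

(* Each [m <= n] is at least the product of its prime divisors. *)
Lemma prod_primes_pow_le n : \prod_(1 <= p < n.+1 | prime p) p ^ (n %/ p) <= n ^ n.
Proof.
have -> : \prod_(1 <= p < n.+1 | prime p) p ^ (n %/ p) =
    \prod_(1 <= m < n.+1) \prod_(1 <= p < n.+1 | prime p && (p %| m)) p.
  rewrite (exchange_big_dep prime) /=; last by move=> m p _ /andP[].
  apply: eq_bigr => p p_pr; rewrite -(count_multiples n (prime_gt0 p_pr)).
  by rewrite expn_sum; apply: eq_big => m; rewrite ?p_pr ?expn1.
apply: (@leq_trans (\prod_(1 <= m < n.+1) n)); last first.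
  by rewrite prod_nat_const_nat subn1.
rewrite big_nat [leqRHS]big_nat; apply: leq_prod => m /andP[m0 mn].
apply: (@leq_trans m); last by rewrite -ltnS.
apply: dvdn_leq => //.
by apply: prod_primes_cond_dvd.
Qed.

(** As [N < p * p] here, [N] raised to this sum is at most the square of the product in
    [prod_primes_pow_le], that is [N ^ (2 * N)]. *)
Lemma sum_large_primes N :
  \sum_(1 <= p < N.+1 | prime p && (N < p * p)) N %/ p <= 2 * N.
Proof.
have [N1|N1] := leqP N 1.
  rewrite big_nat_cond big1 // => p /andP[/andP[_ hp]] /andP[p_pr _].
  by have := prime_gt1 p_pr; lia.
rewrite -(leq_exp2l _ _ N1) expn_sum.
apply: (@leq_trans ((\prod_(1 <= p < N.+1 | prime p) p ^ (N %/ p)) ^ 2)).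
  rewrite (big_morph (fun x => x ^ 2) (fun x y => expnMn x y 2) (exp1n 2)).
  rewrite [leqRHS](bigID (fun p => N < p * p)) /=.
  rewrite -[leqLHS]muln1; apply: leq_mul.
    apply: leq_prod => p /andP[_ hp]; rewrite -expnM mulnC expnM.
    by apply: leq_exp_base; rewrite -mulnn ltnW.
  by apply: prodn_cond_gt0 => p /andP[p_pr _]; rewrite !expn_gt0 prime_gt0.
by rewrite mulnC expnM; apply: leq_exp_base; exact: prod_primes_pow_le.
Qed.

(** Bernoulli's inequality [(1 - 1/p)^m >= 1 - m/p] at [m = ceil(p/2)] bounds [p^m] by [3 (p-1)^m],
    and squaring gives the constant 9. It is relaxed to 16, a power of 2, for the later comparison
    of exponents of 2. *)
Lemma pow_pred_le p : 2 <= p -> p ^ p <= 16 * p.-1 ^ p.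
Proof.
case: p => // q; rewrite ltnS => q0 /=.
have bern m : m <= q -> q.+1 ^ m * (q.+1 - m) <= q ^ m * q.+1.
  elim: m => [|m IH] mq; first by rewrite !expn0 subn0.
  have := IH (ltnW mq); rewrite !expnS => h.
  have h2 : q.+1 * (q.+1 - m.+1) <= q * (q.+1 - m) by nia.
  apply: (@leq_trans (q.+1 ^ m * (q * (q.+1 - m)))).
    by rewrite -mulnA mulnCA leq_mul2l h2 orbT.
  by rewrite mulnCA -mulnA leq_mul2l h orbT.
pose m := q.+1 - q.+1./2.
have hm : m <= q by rewrite /m; lia.
have h3 : q.+1 ^ m <= 3 * q ^ m.
  have := bern m hm; have -> : q.+1 - m = q.+1./2 by rewrite /m; lia.
  have t : q.+1 <= 3 * q.+1./2 by lia.
  move=> h; have h0 : 0 < q.+1./2 by lia.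
  rewrite -(leq_pmul2r h0); apply: leq_trans h _.
  by rewrite [3 * _]mulnC -mulnA leq_mul2l t orbT.
have h9 : q.+1 ^ (2 * m) <= 9 * q ^ (2 * m).
  by rewrite mulnC !expnM -[9]/(3 ^ 2) -expnMn; apply: leq_exp_base.
have [l hl] : exists l, 2 * m = l + q.+1 by exists (2 * m - q.+1); rewrite /m; lia.
rewrite hl !expnD in h9.
have ql : 0 < q.+1 ^ l by rewrite expn_gt0.
have ql' : q ^ l <= q.+1 ^ l by apply: leq_exp_base.
rewrite -(leq_pmul2l ql); apply: leq_trans h9 _.
by rewrite mulnCA mulnA [16 * _]mulnC mulnA; nia.
Qed.

(* [sum Y/p] over the primes [p >= 2^h] is controlled through [p^(Y/p)] and
   [prod_primes_pow_le]; the choice [h = 16 e] makes the product at most [2^S]. *)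
Lemma prod_primes_shift Y S e : 0 < e -> 2 ^ (e * (2 * S)) = Y ->
  \prod_(2 ^ (16 * e) <= p < Y | prime p) p <=
  2 ^ S * \prod_(2 ^ (16 * e) <= p < Y | prime p) p.-1.
Proof.
move=> e0 hY; have Y0 : 0 < Y by rewrite -hY expn_gt0.
rewrite -(@leq_exp2r _ _ Y) // expnMn.
set W := \sum_(2 ^ (16 * e) <= p < Y | prime p) Y %/ p.
have hW : 8 * W <= S * Y.
  have : 2 ^ (16 * e * W) <= 2 ^ (e * (2 * S) * Y).
    rewrite expnM [leqRHS]expnM hY; apply: leq_trans (prod_primes_pow_le Y).
    have [hY2|hY2] := leqP Y (2 ^ (16 * e)).
      rewrite /W big_geq // expn0; apply: prodn_cond_gt0 => p p_pr.
      by rewrite expn_gt0 prime_gt0.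
    have h1 : 1 <= 2 ^ (16 * e) by rewrite expn_gt0.
    rewrite (big_cat_nat h1 (leqW (ltnW hY2))) /= -[leqLHS]mul1n; apply: leq_mul.
      by apply: prodn_cond_gt0 => p p_pr; rewrite expn_gt0 prime_gt0.
    rewrite big_mkcond big_nat_recr /=; last exact: ltnW.
    rewrite -[leqLHS]muln1; apply: leq_mul; last first.
      by case: ifP => // p_pr; rewrite expn_gt0 prime_gt0.
    rewrite -big_mkcond /= expn_sum big_nat_cond [leqRHS]big_nat_cond.
    by apply: leq_prod => p /andP[/andP[hp _] _]; apply: leq_exp_base.
  by rewrite leq_exp2l //; nia.
(* Since [Y %/ p >= 1], [Y <= p * t]: the power [t] of [pow_pred_le] reaches the exponent [Y], at
   the cost [16 ^ t = 2 ^ (8 * (Y %/ p))]. *)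
have hp p : prime p -> p < Y -> p ^ Y <= 2 ^ (8 * (Y %/ p)) * p.-1 ^ Y.
  move=> p_pr pY; have [t ht] : exists t, t = 2 * (Y %/ p) by exists (2 * (Y %/ p)).
  have p0 := prime_gt0 p_pr; have p1 := prime_gt1 p_pr.
  have h1 : (p ^ p) ^ t <= (16 * p.-1 ^ p) ^ t.
    by apply: leq_exp_base; exact: pow_pred_le.
  have hY1 : Y <= p * t.
    have d0 : 0 < Y %/ p by rewrite divn_gt0 // ltnW.
    by rewrite ht; have := ltn_ceil Y p0; rewrite mulSn; nia.
  have [l hl] : exists l, p * t = l + Y by exists (p * t - Y); rewrite subnK.
  rewrite expnMn -!expnM hl !expnD in h1.
  have pl : 0 < p ^ l by rewrite expn_gt0 p0.
  have pl' : p.-1 ^ l <= p ^ l by apply: leq_exp_base; exact: leq_pred.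
  rewrite -(leq_pmul2l pl); apply: leq_trans h1 _.
  have -> : 2 ^ (8 * (Y %/ p)) = 16 ^ t.
    by rewrite ht -[16]/(2 ^ 4) -expnM mulnA.
  by rewrite mulnCA leq_mul2r pl' orbT.
apply: (@leq_trans (2 ^ (8 * W) * (\prod_(2 ^ (16 * e) <= p < Y | prime p) p.-1) ^ Y)).
  rewrite !(big_morph (fun x => x ^ Y) (fun x y => expnMn x y Y) (exp1n Y)).
  rewrite big_distrr /= expn_sum -big_split /=.
  rewrite big_nat_cond [leqRHS]big_nat_cond; apply: leq_prod => p /andP[/andP[_ pY] p_pr].
  exact: hp.
by rewrite leq_mul2r -expnM leq_exp2l // hW orbT.
Qed.

(** * Primorials and Euler's totient *)

Definition primorial Y := \prod_(0 <= p < Y | prime p) p.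

Lemma primorial_gt0 Y : 0 < primorial Y.
Proof. by apply: prodn_cond_gt0 => p; exact: prime_gt0. Qed.

Lemma totient_primorial Y : totient (primorial Y) = \prod_(0 <= p < Y | prime p) p.-1.
Proof.
rewrite /primorial; elim: Y => [|Y IH]; first by rewrite !big_geq.
rewrite big_mkcond [in RHS]big_mkcond !big_nat_recr //= -!big_mkcond /=.
case: ifP => [Y_pr|_]; last by rewrite !muln1.
rewrite totient_coprime ?IH ?totient_prime // coprime_sym.
rewrite big_seq_cond; apply: (big_ind (fun x => coprime Y x)).
- exact: coprimen1.
- by move=> x y hx hy; rewrite coprimeMr hx.
move=> q /andP[]; rewrite mem_index_iota => /andP[_ qY] q_pr.
by rewrite prime_coprime // dvdn_prime2 // eq_sym neq_ltn qY.
Qed.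

(** A weak form of Mertens' theorem: for [Y = 2 ^ (e * (2 * S))] the integers prime to all primes
    below [Y] have density at least [Y^(-1/(2e)) / c]. The constant [c] absorbs the primes below
    [2 ^ (16 * e)], which [prod_primes_shift] leaves out. *)
Lemma primorial_totient e : 0 < e -> exists2 c, 0 < c & forall S,
  primorial (2 ^ (e * (2 * S))) <= c * 2 ^ S * totient (primorial (2 ^ (e * (2 * S)))).
Proof.
move=> e0; exists (primorial (2 ^ (16 * e))); first exact: primorial_gt0.
move=> S; set Y := 2 ^ (e * (2 * S)); have hs := prod_primes_shift e0 (erefl Y).
rewrite totient_primorial /primorial; set Z := 2 ^ (16 * e) in hs *.
have pos a b : 0 < \prod_(a <= p < b | prime p) p.-1.
  by apply: prodn_cond_gt0 => p /prime_gt1; lia.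
have mono b c : b <= c -> \prod_(0 <= p < b | prime p) p <= \prod_(0 <= p < c | prime p) p.
  move=> bc; rewrite [leqRHS](big_cat_nat (leq0n b) bc) /= -[leqLHS]muln1.
  by apply: leq_mul => //; apply: prodn_cond_gt0 => p; exact: prime_gt0.
have [YZ|YZ] := leqP Y Z.
  rewrite -mulnA -[leqLHS]muln1; apply: leq_mul; first exact: mono.
  by rewrite muln_gt0 expn_gt0 pos.
rewrite (big_cat_nat (leq0n Z) (ltnW YZ)) /= [X in _ <= _ * X](big_cat_nat (leq0n Z) (ltnW YZ)) /=.
rewrite -mulnA; apply: leq_mul => //; apply: leq_trans hs _.
by rewrite leq_mul2l; apply/orP; right; apply: leq_pmull.
Qed.

(** * Density zero of the primes *)

Definition prime_count N := count prime (iota 1 N).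

Lemma prime_ndvd_fact p n : prime p -> n < p -> ~~ (p %| n`!).
Proof.
move=> p_pr; elim: n => [|n IH] hn; first by rewrite dvdn1 neq_ltn prime_gt1 ?orbT.
by rewrite factS Euclid_dvdM // negb_or IH ?(ltnW hn) // gtnNdvd.
Qed.

(** The primes in [(n, 2n]] all divide ['C(2n, n) <= 4 ^ n], so their number [c] satisfies
    [n ^ c <= 4 ^ n]; then [4 ^ M <= n] gives [M * c <= n]. *)
Lemma prime_count_double n M : 4 ^ M <= n -> M * prime_count n.*2 <= M * prime_count n + n.
Proof.
move=> hM; have n0 : 0 < n by apply: leq_trans hM; rewrite expn_gt0.
rewrite /prime_count -addnn iotaD count_cat mulnDr leq_add2l.
set c := count _ _.
have h : n ^ c <= 4 ^ n.
  apply: (@leq_trans 'C(n + n, n)); last first.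
    apply: (@leq_trans (2 ^ (n + n))); last by rewrite addnn -mul2n expnM.
    rewrite -[2]/(1 + 1) expnDn (bigD1 (inord n)) //=.
    by rewrite inordK ?ltnS ?leq_addr // !exp1n !muln1 leq_addr.
  apply: (@leq_trans (\prod_(p <- iota (1 + n) n | prime p) p)); last first.
    apply: dvdn_leq; first by rewrite bin_gt0 leq_addr.
    rewrite -big_filter; apply: prod_primes_dvd; first by rewrite filter_uniq // iota_uniq.
    move=> p; rewrite mem_filter mem_iota => /andP[p_pr /andP[p1 p2]]; rewrite p_pr /=.
    have : p %| (n + n)`!.
      by rewrite dvdn_fact // prime_gt0 //=; lia.
    rewrite -(@bin_fact (n + n) n) ?leq_addr // addnK Euclid_dvdM // => /orP[//|].
    by rewrite Euclid_dvdM // orbb (negPf (prime_ndvd_fact p_pr p1)).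
  rewrite -[c]muln1 /c -sum1_count big_distrl /= expn_sum.
  rewrite big_seq_cond [leqRHS]big_seq_cond; apply: leq_prod => p /andP[].
  by rewrite mem_iota mul1n expn1 add1n => /andP[/ltnW].
have h2 : 2 ^ (2 * M * c) <= 2 ^ (2 * n).
  rewrite !expnM; apply: leq_trans h; exact: leq_exp_base.
move: h2; rewrite leq_exp2l // -mulnA leq_mul2l; exact.
Qed.

(** Repeated halving with [prime_count_double] yields [M' * prime_count N <= 2 * N + K], where [K]
    covers the small [N]. The factor 4 in [M'] makes room for [K] once [N] is large. *)
Lemma prime_count_density M : exists X, forall N, X <= N -> M * prime_count N <= N.
Proof.
have pc_le N : prime_count N <= N.
  by rewrite /prime_count (leq_trans (count_size _ _)) // size_iota.
have pc_S N : prime_count N.+1 <= (prime_count N).+1.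
  rewrite /prime_count -[N.+1]addn1 iotaD count_cat /= addn0.
  by case: (prime _); rewrite ?addn1 ?addn0 ?leqnSn.
pose M' := 4 * M; pose K := M' * (2 * 4 ^ M' + 2 * M').
have h N : M' * prime_count N <= 2 * N + K.
  elim/ltn_ind: N => N IH.
  have [hN|hN] := leqP N (2 * 4 ^ M' + 2 * M').
    apply: leq_trans (leq_addl _ _); rewrite /K leq_mul2l.
    by rewrite (leq_trans (pc_le N)) ?orbT.
  have h4 : 4 ^ M' <= N./2 by lia.
  have := prime_count_double h4.
  have : N./2 < N by lia.
  move=> /IH h1 h2.
  have : prime_count N <= (prime_count N./2.*2).+1.
    rewrite -{1}(odd_double_half N); case: (odd N); last by rewrite add0n.
    by rewrite add1n pc_S.
  by nia.
exists K.+1 => N hN; have := h N; rewrite /M'; nia.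
Qed.

(** * Common prime factors beyond a bound *)

Lemma geometric_tail (G : nat -> nat) M S l :
  (forall s, S <= s -> G s * 2 ^ s <= M) ->
  (\sum_(S <= s < S + l) G s) * 2 ^ S <= 2 * M.
Proof.
elim: l S => [|l IH] S hG; first by rewrite addn0 big_geq // mul0n.
rewrite big_ltn; last lia.
rewrite mulnDl mul2n -addnn; apply: leq_add; first exact: hG.
have /IH : forall s, S.+1 <= s -> G s * 2 ^ s <= M by move=> s hs; apply: hG; lia.
by rewrite -addSnnS expnS; lia.
Qed.

Lemma sum_scales (F : nat -> nat) b S l : 0 < b ->
  \sum_(b ^ S <= p < b ^ (S + l)) F p =
  \sum_(S <= s < S + l) \sum_(b ^ s <= p < b ^ s.+1) F p.
Proof.
move=> b0; elim: l => [|l IH]; first by rewrite addn0 !big_geq.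
rewrite addnS big_nat_recr /=; last lia.
rewrite -IH -big_cat_nat //; first by rewrite leq_pexp2l // leq_addr.
by rewrite leq_pexp2l.
Qed.

Section Tail.
Variables (z : nat -> pred nat) (p0 e A : nat) (E : nat -> nat).
Hypothesis e0 : 0 < e.
(** The prime factors of [E L] are the exceptional primes for blocks of length at most [L]; its size
    limits their number to [A * L ^ 2]. *)
Hypothesis hE : forall L, 0 < E L <= 2 ^ (A * L ^ 2).
Hypothesis few : forall p L, prime p -> p0 < p -> ~~ (p %| E L) ->
  forall s L', L' <= L -> count (z p) (iota s L') ^ e <= (4 * L') ^ e.-1.

(* [z p m] stands for [p %| u (p * m)], so [z p (n %/ p)] means [p %| u n] when [p %| n]. *)
Definition tail Y n := has (fun p => [&& prime p, Y <= p, p %| n & z p (n %/ p)]) (iota 1 n).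

Lemma count_quotients p N : 0 < p ->
  \sum_(1 <= n < N.+1) ((p %| n) && z p (n %/ p)) = count (z p) (iota 1 (N %/ p)).
Proof.
move=> pp; elim: N => [|N IH]; first by rewrite big_geq // div0n.
rewrite big_nat_recr //= IH divnS //; case: (p %| N.+1); last by rewrite addn0.
have -> : iota 1 (true + N %/ p) = iota 1 (N %/ p) ++ [:: (N %/ p).+1].
  by rewrite addnC iotaD.
by rewrite count_cat /= addn0.
Qed.

Lemma tail_count Y N :
  count (tail Y) (iota 1 N) <= \sum_(Y <= p < N.+1 | prime p) count (z p) (iota 1 (N %/ p)).
Proof.
have -> : \sum_(Y <= p < N.+1 | prime p) count (z p) (iota 1 (N %/ p)) =
   \sum_(Y <= p < N.+1 | prime p) \sum_(1 <= n < N.+1) ((p %| n) && z p (n %/ p)).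
  by apply: eq_bigr => p p_pr; rewrite count_quotients ?prime_gt0.
have -> : iota 1 N = index_iota 1 N.+1 by rewrite /index_iota subn1.
rewrite exchange_big /= -sum1_count big_mkcond /=.
rewrite big_nat [leqRHS]big_nat; apply: leq_sum => n /andP[n0 nN].
case: ifP => // /hasP[p]; rewrite mem_iota => /andP[p1 pn] /and4P[p_pr Yp dn zn].
rewrite big_mkcond (bigD1_seq p) /= ?iota_uniq ?mem_index_iota ?Yp //; last by lia.
by rewrite p_pr dn zn.
Qed.

(** A block of length [L = 2 ^ (e * t)] has at most [(4 L)^(1 - 1/e) <= 4 L / 2 ^ t] zeros, because
    [L^(1/e) = 2 ^ t]. As [L <= X], at most [2 (X %/ L)] blocks cover [[1, X]], which doubles the
    constant. *)
Lemma block_bound p s t X : prime p -> p0 < p -> ~~ (p %| E (2 ^ (e * s))) ->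
  t <= s -> 2 ^ (e * t) <= X -> 2 ^ t * count (z p) (iota 1 X) <= 8 * X.
Proof.
move=> p_pr hp pE ts hX; set L := 2 ^ (e * t).
have L0 : 0 < L by rewrite expn_gt0.
have LL : L <= 2 ^ (e * s) by rewrite leq_exp2l // leq_mul2l ts orbT.
have block a : 2 ^ t * count (z p) (iota a L) <= 4 * L.
  rewrite -(@leq_exp2r _ _ e) // expnMn -expnM mulnC [t * e]mulnC -/L.
  have := few p_pr hp pE a LL; move: (count _ _) => c hc.
  rewrite -[X in _ <= _ ^ X](prednK e0) expnS mulnC; apply: leq_mul => //.
  by rewrite -[leqLHS]mul1n leq_mul2r orbT.
have blocks q a : 2 ^ t * count (z p) (iota a (q * L)) <= q * (4 * L).
  elim: q a => [|q IH] a; first by rewrite !mul0n muln0.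
  by rewrite mulSn iotaD count_cat mulnDr mulSn leq_add.
have hq := ltn_ceil X L0.
apply: (@leq_trans ((X %/ L).+1 * (4 * L))); last first.
  have := leq_trunc_div X L; have : 0 < X %/ L by rewrite divn_gt0.
  by nia.
apply: leq_trans (blocks (X %/ L).+1 1); rewrite leq_mul2l; apply/orP; right.
by rewrite -(subnKC (ltnW hq)) iotaD count_cat leq_addr.
Qed.

(* Primes are grouped in the scales [b^s <= p < b^(s+1)], with zeros counted in blocks of
   length [2^(e s)]: the [O(4^(e s))] exceptional primes of a scale then contribute
   [O(4^(e s) / b^s) = O(2^(-s))], as much as the other ones. *)
Let b := 2 ^ (2 * e).+1.
Let cz N p := count (z p) (iota 1 (N %/ p)).
Let b0 : 0 < b. Proof. by rewrite expn_gt0. Qed.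
Let b1 : 1 < b. Proof. by rewrite -[1]/(2 ^ 0) ltn_exp2l. Qed.

Let cz_le N p : cz N p <= N %/ p.
Proof. by rewrite /cz (leq_trans (count_size _ _)) // size_iota. Qed.

Let exceptional p s := p %| E (2 ^ (e * s)).

(** The product of these primes divides [E (2 ^ (e * s))], and each of them is at least 2. *)
Let exceptional_count s :
  \sum_(b ^ s <= p < b ^ s.+1 | prime p && exceptional p s) 1 <= A * 2 ^ (2 * e * s).
Proof.
have /andP[E0 hEs] := hE (2 ^ (e * s)).
rewrite -(leq_exp2l _ _ (ltnSn 1)) expn_sum.
apply: (@leq_trans (2 ^ (A * (2 ^ (e * s)) ^ 2))); last first.
  by rewrite -expnM leq_exp2l // mulnAC [e * 2]mulnC.
apply: leq_trans hEs; apply: (@leq_trans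
  (\prod_(b ^ s <= p < b ^ s.+1 | prime p && exceptional p s) p)).
  by apply: leq_prod => p /andP[p_pr _]; rewrite expn1 prime_gt1.
by apply: dvdn_leq => //; apply: prod_primes_cond_dvd.
Qed.

(** A prime left out at its own scale [s] is not exceptional and has [N %/ p < 2 ^ (e * s) <= p],
    hence [N < p * p]. *)
Let main_part N p s := if exceptional p s || (2 ^ (e * s) <= N %/ p) then cz N p else 0.

(** There are at most [b ^ s.+1] ordinary primes, each contributing at most [8 (N / b ^ s) / 2 ^ s];
    this gives [8 * b]. The at most [A * 2 ^ (2 * e * s)] exceptional ones contribute [N / b ^ s]
    each, and [b ^ s = 2 ^ (2 * e * s) * 2 ^ s]. *)
Let scale_sum N s : p0 < b ^ s ->
  (\sum_(b ^ s <= p < b ^ s.+1 | prime p) main_part N p s) * 2 ^ s <= (8 * b + A) * N.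
Proof.
move=> hs; have bs0 : 0 < b ^ s by rewrite expn_gt0 b0.
rewrite (bigID (fun p => exceptional p s)) /= mulnDl [(_ + A) * N]mulnDl addnC.
apply: leq_add.
  rewrite big_distrl /=; apply: (@leq_trans (\sum_(b ^ s <= p < b ^ s.+1) 8 * (N %/ b ^ s))).
    rewrite big_mkcond big_nat [leqRHS]big_nat; apply: leq_sum => p /andP[hp _].
    case: ifP => // /andP[p_pr pE]; rewrite /main_part (negPf pE) /=.
    case: ifP => // hX; rewrite mulnC; apply: leq_trans (block_bound p_pr _ pE _ hX) _ => //.
      exact: leq_trans hp.
    by rewrite leq_mul2l leq_div2l ?orbT.
  rewrite sum_nat_const_nat expnS.
  have := leq_trunc_div N (b ^ s); move: (N %/ b ^ s) (b ^ s) => q B; nia.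
apply: (@leq_trans
  ((\sum_(b ^ s <= p < b ^ s.+1 | prime p && exceptional p s) N %/ b ^ s) * 2 ^ s)).
  rewrite leq_mul2r; apply/orP; right.
  rewrite big_nat_cond [leqRHS]big_nat_cond; apply: leq_sum => p /andP[/andP[hp _] _].
  rewrite /main_part; case: ifP => // _; apply: leq_trans (cz_le _ _) _.
  by rewrite leq_div2l.
rewrite -[X in (\sum_(_ <= _ < _ | _) X)]muln1 -big_distrr /=.
have h1 := exceptional_count s; have h2 := leq_trunc_div N (b ^ s).
have eb : b ^ s = 2 ^ (2 * e * s) * 2 ^ s by rewrite -expnD -expnM mulSn addnC.
move: h1 h2 eb; move: (\sum_(_ <= _ < _ | _) 1) (N %/ _) => c q.
move: (b ^ s) (2 ^ (2 * e * s)) (2 ^ s) => B x y hc hq eB; rewrite eB in hq.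
by apply: leq_trans (leq_mul (leqnn A) hq); have := leq_mul hc (leqnn (q * y)); nia.
Qed.

(** The three summands of the constant belong to three kinds of primes: those counted by
    [main_part], summed geometrically over the scales; those with [N < p * p], treated with blocks
    of length [2 ^ (e * S)] and [sum_large_primes]; and those with [N %/ p <= 2 ^ (e * S)], for
    which the trivial count suffices because primes have density zero. *)
Lemma tail_bound : exists C S0, forall S, S0 <= S -> exists X, forall N, X <= N ->
  2 ^ S * count (tail (b ^ S)) (iota 1 N) <= C * N.
Proof.
exists (2 * (8 * b + A) + 16 + 1), p0.+1 => S hS.
(* The third kind costs at most [2 ^ S * 2 ^ (e * S)] for each prime up to [N]. *)
have [X hX] := prime_count_density (2 ^ S * 2 ^ (e * S)).
exists X => N /hX hN.
have p0S s : S <= s -> p0 < b ^ s.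
  by move=> ss; apply: leq_trans (ltn_expl _ b1); lia.
apply: (@leq_trans (2 ^ S * \sum_(b ^ S <= p < N.+1 | prime p) cz N p)).
  by rewrite leq_mul2l tail_count orbT.
rewrite big_distrr /=.
have term p : b ^ S <= p -> prime p ->
    2 ^ S * cz N p <= 2 ^ S * main_part N p (trunc_log b p) +
      (if N < p * p then 8 * (N %/ p) else 0) + 2 ^ S * 2 ^ (e * S).
  move=> hp p_pr; set s := trunc_log b p.
  have [hX2|hX2] := leqP (N %/ p) (2 ^ (e * S)).
    apply: leq_trans (leq_addl _ _); rewrite leq_mul2l.
    by rewrite (leq_trans (cz_le _ _)) ?orbT.
  apply: leq_trans (leq_addr _ _).
  rewrite /main_part; case: ifP => [_|]; first exact: leq_addr.
  move=> /negbT; rewrite negb_or -ltnNge muln0 add0n => /andP[pE hs].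
  have p_gt0 := prime_gt0 p_pr.
  have sp : b ^ s <= p by exact: trunc_logP.
  have Ss : S <= s by apply: trunc_log_max.
  have Np : N < p * p.
    have : N %/ p < p.
      apply: leq_trans hs (leq_trans _ sp); rewrite /b -expnM leq_exp2l //; nia.
    by rewrite ltn_divLR.
  rewrite Np; apply: (block_bound p_pr _ pE Ss (ltnW hX2)).
  by apply: leq_trans (p0S S _) hp.
apply: (@leq_trans (\sum_(b ^ S <= p < N.+1 | prime p)
    (2 ^ S * main_part N p (trunc_log b p) +
      (if N < p * p then 8 * (N %/ p) else 0) + 2 ^ S * 2 ^ (e * S)))).
  rewrite big_nat_cond [leqRHS]big_nat_cond.
  by apply: leq_sum => p /andP[/andP[hp _] p_pr]; exact: term.
rewrite !big_split /= [(_ + 1) * N]mulnDl mul1n [(_ + 16) * N]mulnDl.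
have bS1 : 1 <= b ^ S by rewrite expn_gt0 b0.
have shrink (F : nat -> nat) : \sum_(b ^ S <= p < N.+1 | prime p) F p <=
    \sum_(1 <= p < N.+1 | prime p) F p.
  have [h|h] := leqP (b ^ S) N.+1; last by rewrite big_geq // ltnW.
  by rewrite [leqRHS](big_cat_nat bS1 h) leq_addl.
apply: leq_add; first apply: leq_add.
- pose T := S + N.+1.
  have NT : N.+1 <= b ^ T by apply: leq_trans (ltnW (ltn_expl _ b1)); rewrite /T; lia.
  rewrite -big_distrr /= mulnC.
  apply: (@leq_trans
    ((\sum_(S <= s < T) \sum_(b ^ s <= p < b ^ s.+1 | prime p) main_part N p s) * 2 ^ S));
    last first.
    rewrite -mulnA; apply: geometric_tail => s ss; apply: scale_sum; exact: p0S.
  rewrite leq_mul2r; apply/orP; right.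
  rewrite big_mkcond /=; pose F p := if prime p then main_part N p (trunc_log b p) else 0.
  apply: (@leq_trans (\sum_(b ^ S <= p < b ^ T) F p)).
    have [h|h] := leqP (b ^ S) N.+1; last by rewrite big_geq // ltnW.
    by rewrite [leqRHS](big_cat_nat h NT) leq_addr.
  rewrite sum_scales // big_nat [leqRHS]big_nat; apply: leq_sum => s _.
  rewrite [leqRHS]big_mkcond big_nat [leqRHS]big_nat; apply: leq_sum => p hp.
  by rewrite /F (trunc_log_eq b1 hp).
- apply: leq_trans (shrink _) _; rewrite -big_mkcondr -big_distrr /=.
  by apply: (@leq_trans (8 * (2 * N))); [rewrite leq_mul2l sum_large_primes | lia].
apply: leq_trans (shrink _) _; rewrite -[X in \sum_(_ <= _ < _ | _) X]muln1 -big_distrr /=.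
by rewrite /index_iota subn1 sum1_count.
Qed.
End Tail.

(** * Densities of sieved sets *)

Lemma leq_count_in (T : eqType) (P Q : pred T) (s : seq T) :
  (forall x, x \in s -> P x -> Q x) -> count P s <= count Q s.
Proof.
elim: s => //= x s IH h; apply: leq_add.
  by have := h x (mem_head _ _); case: (P x) => // ->.
by apply: IH => y ys; apply: h; rewrite inE ys orbT.
Qed.

(** The interval splits into [[1, n1]], full periods and an incomplete one; only the first and last
    pieces enter the error. *)
Lemma periodic_count (P : pred nat) T n1 : 0 < T ->
  (forall n, n1 <= n -> P (n + T) = P n) ->
  forall N, (T * count P (iota 1 N) <= count P (iota n1 T) * N + 2 * T * (n1 + T)) /\
    (count P (iota n1 T) * N <= T * count P (iota 1 N) + 2 * T * (n1 + T)).
Proof.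
move=> T0 hP N; set w := count P (iota n1 T).
have count_le a l : count P (iota a l) <= l by rewrite (leq_trans (count_size _ _)) ?size_iota.
have wT : w <= T by exact: count_le.
have per a : count P (iota (n1 + a) T) = w.
  elim: a => [|a IH]; first by rewrite addn0.
  have : count P (iota (n1 + a) T.+1) = count P (iota (n1 + a) (T + 1)) by rewrite addn1.
  rewrite iotaD count_cat IH /= addn0 hP ?leq_addr // addnS; lia.
have pers q : count P (iota n1.+1 (q * T)) = q * w.
  elim: q => [|q IH] //; rewrite mulSnr iotaD count_cat IH mulSnr; congr (_ + _).
  by rewrite addSnnS per.
have [hN|hN] := leqP N n1.
  by have := count_le 1 N; nia.
have := divn_eq (N - n1) T; have := ltn_pmod (N - n1) T0.
move: (_ %/ _) (_ %% _) => q r hr eN.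
have e : count P (iota 1 N) = count P (iota 1 n1) + q * w + count P (iota (n1.+1 + q * T) r).
  have -> : N = n1 + (q * T + r) by lia.
  by rewrite !iotaD !count_cat add1n pers addnA.
rewrite e; have -> : N = n1 + (q * T + r) by lia.
have := count_le 1 n1; have := count_le (n1.+1 + q * T) r.
move: (count P (iota 1 n1)) (count P (iota _ r)) => c1 c2 h2 h3.
clear per pers e; move: w wT => w' h1.
have wr : w' * r <= T * T by apply: leq_mul => //; exact: ltnW.
have wn : w' * n1 <= T * n1 by rewrite leq_mul2r h1 orbT.
have c1T : T * c1 <= T * n1 by rewrite leq_mul2l h3 orbT.
have c2T : T * c2 <= T * T by rewrite leq_mul2l (leq_trans h2 (ltnW hr)) orbT.
split; nia.
Qed.

Section Density.
Variables (z : nat -> pred nat) (e C S0 : nat) (A : pred nat).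
Let b := 2 ^ (2 * e).+1.

Definition avoid Y n :=
  all (fun p => prime p ==> ~~ ((p %| n) && z p (n %/ p))) (iota 0 Y).

Hypothesis htail : forall S, S0 <= S -> exists X, forall N, X <= N ->
  2 ^ S * count (tail z (b ^ S)) (iota 1 N) <= C * N.
Hypothesis A_avoid : forall Y n, 0 < n -> A n -> avoid Y n.
Hypothesis avoid_A : forall Y n, 0 < n -> avoid Y n -> ~~ tail z Y n -> A n.
Hypothesis periodic : forall Y, exists T n1, 0 < T /\
  forall n, n1 <= n -> avoid Y (n + T) = avoid Y n.

Let cnt N := count A (iota 1 N).

Let sandwich Y N :
  cnt N <= count (avoid Y) (iota 1 N) <= cnt N + count (tail z Y) (iota 1 N).
Proof.
apply/andP; split.
  apply: leq_count_in => n; rewrite mem_iota => /andP[n0 _]; exact: A_avoid.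
rewrite /cnt -count_predUI; apply: leq_trans (leq_addr _ _).
apply: leq_count_in => n; rewrite mem_iota => /andP[n0 _] /= h.
by case: (boolP (tail z Y n)) => ht; rewrite ?orbT // (avoid_A n0 h ht).
Qed.

(** The density [w / T] of the periodic set [avoid (b ^ S)] is within [1 / M] of [cnt N / N]: half
    of the error is allotted to the tail, through [2 ^ S >= 2 * M * C], and half to the boundary
    terms of [periodic_count], through the size of [N]. *)
Lemma count_cauchy M : 0 < M -> exists T w X, 0 < T /\ forall N, X <= N ->
  M * (T * cnt N) <= M * (w * N) + T * N /\ M * (w * N) <= M * (T * cnt N) + T * N.
Proof.
move=> M0; pose S := S0 + 2 * M * C.+1.
have [X hX] := htail (leq_addr (2 * M * C.+1) S0).
have [T [n1 [T0 hT]]] := periodic (b ^ S).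
have hc := periodic_count T0 hT; set w := count _ _ in hc; set K := 2 * T * (n1 + T) in hc.
exists T, w, (X + 2 * M * K); split=> // N hN.
have [h1 h2] := hc N.
have /andP[h3 h4] := sandwich (b ^ S) N.
have h5 : 2 ^ S * count (tail z (b ^ S)) (iota 1 N) <= C * N by apply: hX; lia.
have hS : 2 * M * C.+1 <= 2 ^ S by rewrite (leq_trans _ (ltnW (ltn_expl S (ltnSn 1)))) // leq_addl.
move: h1 h2 h3 h4 h5 hS; move: (cnt N) (count (avoid _) _) (count (tail _ _) _) (2 ^ S).
move=> c a t x h1 h2 h3 h4 h5 hS.
have ht : 2 * M * t <= N.
  have : C.+1 * (2 * M * t) <= C.+1 * N.
    rewrite mulnA [C.+1 * _]mulnC; apply: (@leq_trans (x * t)); first by rewrite leq_mul2r hS orbT.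
    by apply: leq_trans h5 _; rewrite leq_mul2r leqnSn orbT.
  by rewrite leq_pmul2l.
have hK : 2 * M * K <= N by lia.
have q1 : M * (T * c) <= M * (T * a) by rewrite !leq_mul2l h3 !orbT.
have q2 : M * (T * a) <= M * (T * c) + T * (M * t) by rewrite -(leq_pmul2l T0) in h4; nia.
have q3 : T * (2 * M * t) <= T * N by rewrite leq_mul2l ht orbT.
have q4 : 2 * M * K <= T * N by apply: leq_trans hK _; rewrite leq_pmull.
by split; nia.
Qed.

(** Integers prime to [Q = primorial Y] satisfy [avoid Y] and have density at least
    [1 / (c * 2 ^ S)] for [Y = b ^ (2 * S)], whereas the tail has density at most [C / 4 ^ S]. With
    [2 ^ S >= 4 * c * C] the tail takes at most a quarter of [phi / Q], the boundary terms another
    quarter, and what remains is at least [N / (2 * Q)]. *)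
Lemma count_lower_bound : exists M X, 0 < M /\ forall N, X <= N -> N <= M * cnt N.
Proof.
have [c c0 hcp] := primorial_totient (ltn0Sn (2 * e)).
pose S := S0 + 4 * c * C; set x := 2 ^ S.
have hS : 4 * c * C <= x by rewrite (leq_trans _ (ltnW (ltn_expl S (ltnSn 1)))) // leq_addl.
have [|X hX] := htail (S := 2 * S); first by rewrite /S; lia.
set Y := b ^ (2 * S) in hX.
have hY : 2 ^ ((2 * e).+1 * (2 * S)) = Y by rewrite expnM.
have := hcp S; rewrite hY; set Q := primorial Y; set phi := totient Q => hQ.
have Q0 : 0 < Q := primorial_gt0 Y.
have per n : 0 <= n -> coprime Q (n + Q) = coprime Q n by rewrite /coprime gcdnDr.
have hc := periodic_count Q0 per.
have phiE : count (coprime Q) (iota 0 Q) = phi.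
  rewrite /phi totient_count_coprime -sum1_count big_mkcond /index_iota subn0.
  by apply: eq_bigr => i _; case: coprime.
rewrite phiE add0n in hc; set K := 2 * Q * Q in hc.
have phi0 : 0 < phi by rewrite totient_gt0.
exists (2 * Q), (X + 4 * K); split; first by rewrite muln_gt0.
move=> N hN; have [_ h1] := hc N.
have /andP[_ h2] := sandwich Y N.
have h3 : count (coprime Q) (iota 1 N) <= count (avoid Y) (iota 1 N).
  apply: sub_count => n hn; apply/allP => p; rewrite mem_iota add0n => /andP[_ pY].
  apply/implyP => p_pr; apply: contraL hn => /andP[pn _].
  have pQ : p %| Q.
    rewrite /Q /primorial big_mkcond (bigD1_seq p) ?mem_index_iota ?iota_uniq //=.
    by rewrite p_pr dvdn_mulr.
  apply/negP => /eqP cop; have : p %| gcdn Q n by rewrite dvdn_gcd pQ.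
  by rewrite cop dvdn1 => /eqP p1; move: p_pr; rewrite p1.
have h4 : 2 ^ (2 * S) * count (tail z Y) (iota 1 N) <= C * N by apply: hX; lia.
have ex : 2 ^ (2 * S) = x ^ 2 by rewrite mulnC expnM.
rewrite ex in h4.
have x0 : 0 < x by rewrite expn_gt0.
move: h1 h2 h3 h4; move: (cnt N) (count (avoid _) _) (count (tail _ _) _) (count _ _).
move=> a v t g h1 h2 h3 h4.
have k1 : phi * N <= Q * (a + t) + K.
  by apply: leq_trans h1 _; rewrite leq_add2r leq_mul2l (leq_trans h3 h2) orbT.
have k2 : 4 * (Q * (C * N)) <= x ^ 2 * (phi * N).
  apply: (@leq_trans (c * x * phi * (4 * (C * N)))).
    by rewrite mulnCA leq_mul2r hQ orbT.
  have -> : c * x * phi * (4 * (C * N)) = (4 * c * C) * (x * (phi * N)) by ring.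
  have -> : x ^ 2 * (phi * N) = x * (x * (phi * N)) by rewrite expnS expn1 -mulnA.
  by rewrite leq_mul2r hS orbT.
have k3 : 4 * (x ^ 2 * K) <= x ^ 2 * (phi * N).
  rewrite mulnCA leq_mul2l; apply/orP; right.
  by apply: (@leq_trans N); [lia | exact: leq_pmull].
have k4 : x ^ 2 * (phi * N) <= Q * (x ^ 2 * a) + Q * (C * N) + x ^ 2 * K.
  apply: (@leq_trans (x ^ 2 * (Q * (a + t) + K))); first by rewrite leq_mul2l k1 orbT.
  have : Q * (x ^ 2 * t) <= Q * (C * N) by rewrite leq_mul2l h4 orbT.
  by move: (x ^ 2) => y; nia.
have x2 : 0 < x ^ 2 by rewrite expn_gt0 x0.
have : x ^ 2 * (phi * N) <= x ^ 2 * (2 * Q * a) by move: k2 k3 k4; move: (x ^ 2) => y; nia.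
by rewrite leq_pmul2l // => h; apply: leq_trans h; exact: leq_pmull.
Qed.
End Density.

(** * Repeated differences *)

Lemma count_pairs (Z : pred nat) s L :
  2 * \sum_(m <- iota s L) Z m * count Z (iota m.+1 (s + L - m.+1)) =
  count Z (iota s L) * (count Z (iota s L)).-1.
Proof.
elim: L s => [|L IH] s; first by rewrite big_nil.
rewrite /= big_cons mulnDr -addSnnS IH addSnnS.
have -> : s + L.+1 - s.+1 = L by lia.
by case: (Z s) => /=; set N := count _ _; [case: N => //= N; nia | lia].
Qed.

Lemma shift_pigeonhole (Z : pred nat) s L F :
  (forall d, 0 < d < L -> count (fun m => Z m && Z (m + d)) (iota s L) <= F) ->
  count Z (iota s L) * (count Z (iota s L)).-1 <= 2 * (L * F).
Proof.
move=> hF; rewrite -count_pairs leq_mul2l /=.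
apply: (@leq_trans (\sum_(1 <= d < L) count (fun m => Z m && Z (m + d)) (iota s L))).
  under [leqRHS]eq_bigr do rewrite -sum1_count big_mkcond.
  rewrite exchange_big /= big_seq [leqRHS]big_seq; apply: leq_sum => m.
  rewrite mem_iota => hm; case: (Z m) => /=; last by rewrite mul0n.
  rewrite mul1n -sum1_count big_mkcond /=.
  have -> : iota m.+1 (s + L - m.+1) = map (addn m) (iota 1 (s + L - m.+1)).
    by rewrite -iotaDl addn1.
  rewrite big_map /= /index_iota; set l := (s + L - m.+1)%N.
  have -> : L - 1 = l + (L - 1 - l) by rewrite /l; lia.
  by rewrite iotaD big_cat leq_addr.
rewrite big_seq; apply: (@leq_trans (\sum_(1 <= d < L) F)).
  by rewrite [leqRHS]big_seq; apply: leq_sum => d; rewrite mem_index_iota; exact: hF.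
by rewrite sum_nat_const_nat leq_mul2r leq_subr orbT.
Qed.

(** If every shift [d] had at most [F] common zeros with [F ^ e <= (4 * L) ^ e.-1], counting pairs
    would give [N (N - 1) <= 2 L F], so [N ^ 2 <= 4 L F] for [N >= 2]. The power [e] of this
    contradicts the assumption. *)
Lemma dense_shift (Z : pred nat) s L e : 0 < e ->
  (4 * L) ^ (2 * e).-1 < count Z (iota s L) ^ (2 * e) ->
  exists2 d, 0 < d < L &
    (4 * L) ^ e.-1 < count (fun m => Z m && Z (m + d)) (iota s L) ^ e.
Proof.
move=> e0 hN; set N := count Z _ in hN.
pose c d := count (fun m => Z m && Z (m + d)) (iota s L).
pose ok d := (0 < d < L) && ((4 * L) ^ e.-1 < c d ^ e).
have [[d /andP[]]|none] := pselect (exists d, ok d); first by exists d.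
have L0 : 0 < L.
  rewrite lt0n; apply/eqP => L0; move: hN; rewrite /N L0 /= muln0 exp0n ?exp0n //; lia.
pose F := \max_(d < L | 0 < d) c d.
have hF d : 0 < d < L -> c d <= F.
  by case/andP=> d0 dL; rewrite /F (bigD1 (Ordinal dL)) //= leq_maxl.
have Fe : F ^ e <= (4 * L) ^ e.-1.
  rewrite /F; elim/big_ind: _ => [|x y hx hy|d d0]; first by rewrite exp0n.
    by rewrite /maxn; case: ifP.
  by rewrite leqNgt; apply/negP => h; apply: none; exists d; rewrite /ok d0 ltn_ord.
have := shift_pigeonhole hF; rewrite -/N => hNF.
have N2 : 2 <= N.
  rewrite leqNgt; apply/negP => N1; move: hN; rewrite ltnNge => /negP; apply.
  apply: (@leq_trans 1); last by rewrite expn_gt0 muln_gt0 L0.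
  by case: (N) N1 => [|[|]] // _; [rewrite exp0n //; lia | rewrite exp1n].
have NN : N ^ 2 <= 4 * L * F by nia.
exfalso; move: hN; rewrite ltnNge => /negP; apply.
have -> : (2 * e).-1 = e + e.-1 by lia.
rewrite expnM expnD; apply: (@leq_trans ((4 * L * F) ^ e)); first by rewrite leq_exp2r.
by rewrite expnMn leq_mul2l Fe orbT.
Qed.

Local Open Scope ring_scope.

(** * Linear recurrences and exponential polynomials *)

Section ShiftOperators.
Variable R : comNzRingType.
Implicit Types (p q : {poly R}) (u v : nat -> R).

(* The action of polynomials on sequences in which ['X] is the shift. *)
Definition act p u n := \sum_(i < size p) p`_i * u (n + i)%N.

Lemma act_widen m p u n : (size p <= m)%N ->
  act p u n = \sum_(i < m) p`_i * u (n + i)%N.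
Proof.
move=> h; rewrite /act (big_ord_widen _ (fun i => p`_i * u (n + i)%N) h).
rewrite big_mkcond; apply: eq_bigr => i _; case: ltnP => // hi.
by rewrite nth_default // mul0r.
Qed.

Lemma eq_act p u v n : u =1 v -> act p u n = act p v n.
Proof. by move=> h; apply: eq_bigr => i _; rewrite h. Qed.

Lemma actDl p q u n : act (p + q) u n = act p u n + act q u n.
Proof.
rewrite (act_widen _ _ (size_polyD p q)) (act_widen _ _ (leq_maxl _ (size q))).
rewrite (act_widen _ _ (leq_maxr (size p) _)) -big_split /=.
by apply: eq_bigr => i _; rewrite coefD mulrDl.
Qed.

Lemma actZl c p u n : act (c *: p) u n = c * act p u n.
Proof.
rewrite (act_widen _ _ (size_scale_leq c p)) mulr_sumr.
by apply: eq_bigr => i _; rewrite coefZ mulrA.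
Qed.

Lemma act0l u n : act 0 u n = 0.
Proof. by rewrite /act size_poly0 big_ord0. Qed.

Lemma act_suml (I : Type) (r : seq I) (F : I -> {poly R}) u n :
  act (\sum_(i <- r) F i) u n = \sum_(i <- r) act (F i) u n.
Proof.
elim: r => [|i r IH]; first by rewrite !big_nil act0l.
by rewrite !big_cons actDl IH.
Qed.

Lemma actNl p u n : act (- p) u n = - act p u n.
Proof. by rewrite -scaleN1r actZl mulN1r. Qed.

Lemma actC c u n : act c%:P u n = c * u n.
Proof. by rewrite (act_widen _ _ (size_polyC_leq1 c)) big_ord1 coefC eqxx addn0. Qed.

Lemma act1 u n : act 1 u n = u n.
Proof. by rewrite -polyC1 actC mul1r. Qed.

Lemma act_mulX p u n : act (p * 'X) u n = act p u n.+1.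
Proof.
have h : (size (p * 'X)%R <= (size p).+1)%N.
  by apply: leq_trans (size_polyMleq _ _) _; rewrite size_polyX addn2.
rewrite (act_widen _ _ h) big_ord_recl coefMX mul0r add0r.
by apply: eq_bigr => i _; rewrite coefMX /= addSnnS.
Qed.

Lemma act_Xn m u n : act 'X^m u n = u (n + m)%N.
Proof.
elim: m n => [|m IH] n; first by rewrite expr0 act1 addn0.
by rewrite exprSr act_mulX IH addSnnS.
Qed.

Lemma actM p q u n : act (p * q) u n = act p (act q u) n.
Proof.
elim/poly_ind: p n => [|p c IH] n; first by rewrite mul0r !act0l.
rewrite mulrDl -mulrA ['X * q]mulrC mulrA mul_polyC !actDl actZl actC.
by rewrite !act_mulX IH.
Qed.

Lemma actMC p q u n : act (p * q) u n = act q (act p u) n.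
Proof. by rewrite mulrC actM. Qed.

Lemma act0r p n : act p (fun=> 0) n = 0.
Proof. by rewrite /act big1 // => i _; rewrite mulr0. Qed.

Lemma act_sumr (I : Type) (r : seq I) p (F : I -> nat -> R) n :
  act p (fun m => \sum_(i <- r) F i m) n = \sum_(i <- r) act p (F i) n.
Proof. by rewrite exchange_big; apply: eq_bigr => i _; rewrite mulr_sumr. Qed.

Lemma act_dvd p q u : (forall n, act p u n = 0) -> forall n, act (q * p) u n = 0.
Proof. by move=> h n; rewrite actM (eq_act _ _ h) act0r. Qed.

Lemma act_recurrence k (c : nat -> R) u n :
  act ('X^k - \sum_(1 <= i < k.+1) c i *: 'X^(k - i)) u n =
  u (n + k)%N - \sum_(1 <= i < k.+1) c i * u (n + k - i)%N.
Proof.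
rewrite actDl actNl act_Xn act_suml; congr (_ - _).
rewrite !big_nat; apply: eq_bigr => i /andP[_ hi].
by rewrite actZl act_Xn addnBA.
Qed.

Lemma act_index p v n :
  act p (fun m => m.+1%:R * v m) n = n.+1%:R * act p v n + act ('X * p^`()) v n.
Proof.
elim/poly_ind: p n => [|p c IH] n.
  by rewrite deriv0 mulr0 !act0l mulr0 addr0.
rewrite derivMXaddC mulrDr mulrA !actDl !actC !act_mulX IH ['X * p]mulrC act_mulX.
by rewrite -[n.+2%:R]natr1; ring.
Qed.

(* [u_n = (n+1) v_n] turns an annihilator [Q] of [v] into the new annihilator
   [X P Q'], so that repeated differentiation of [Q] ends with a power of [X P]. *)
Lemma act_index_deriv P Q v :
  (forall n, act P (fun m => m.+1%:R * v m) n = 0) ->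
  (forall n, act Q v n = 0) -> forall n, act ('X * P * Q^`()) v n = 0.
Proof.
move=> hP hQ n.
have e1 := actM Q P (fun m => m.+1%:R * v m) n.
rewrite (eq_act _ _ hP) act0r actMC in e1.
have e2 : act Q (fun m => m.+1%:R * v m) =1 act ('X * Q^`()) v.
  by move=> m; rewrite act_index hQ mulr0 add0r.
by rewrite (eq_act _ _ e2) -actM in e1; rewrite -e1; congr act; ring.
Qed.

(** With [T = X P], [T (T^j Q^(j))' = j T' T^j Q^(j) + T^(j+1) Q^(j+1)], and the first summand
    annihilates [v] by induction. *)
Lemma act_index_derivn P Q v j :
  (forall n, act P (fun m => m.+1%:R * v m) n = 0) ->
  (forall n, act Q v n = 0) -> forall n, act (('X * P) ^+ j * Q^`(j)) v n = 0.
Proof.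
move=> hP hQ; elim: j => [|j IH] n; first by rewrite expr0 mul1r.
set T := 'X * P.
case: j IH => [|j] IH.
  by rewrite expr1 derivn1; exact: act_index_deriv.
have e : 'X * P * (T ^+ j.+1 * Q^`(j.+1))^`() =
    T^`() * (j.+1%:R * (T ^+ j.+1 * Q^`(j.+1))) + T ^+ j.+2 * Q^`(j.+2).
  rewrite derivM deriv_exp -mulr_natl -derivnS -pred_Sn [T ^+ j.+2]exprS exprS -/T; ring.
have := act_index_deriv hP IH n.
by rewrite e actDl mulrA act_dvd // add0r.
Qed.

End ShiftOperators.

Lemma act_map (R S : comNzRingType) (f : {rmorphism R -> S}) p u n :
  act (map_poly f p) (fun m => f (u m)) n = f (act p u n).
Proof.
rewrite (act_widen _ _ (size_poly _ _)) rmorph_sum.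
by apply: eq_bigr => i _; rewrite coef_map rmorphM.
Qed.

(** Differentiating [Q] as often as its degree leaves a constant, nonzero in characteristic 0. The
    gain is an annihilator built from [P] alone, hence with integer coefficients when [P] has
    them. *)
Lemma index_quotient_annihilator (F : fieldType) (P Q : {poly F}) v :
  (forall n, n.+1%:R != 0 :> F) ->
  (forall n, act P (fun m => m.+1%:R * v m) n = 0) -> Q != 0 ->
  (forall n, act Q v n = 0) ->
  exists N, forall n, act (('X * P) ^+ N) v n = 0.
Proof.
move=> F0 hP Q0 hQ; exists (size Q).-1 => n.
have e : Q^`((size Q).-1) = (lead_coef Q *+ (size Q).-1`!)%:P.
  apply/polyP => i; rewrite coef_derivn coefC; case: i => [|i].
    by rewrite addn0 ffactnn.
  by rewrite nth_default ?mul0rn // addnS -addSn prednK ?size_poly_gt0 // leq_addr.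
have := act_index_derivn (size Q).-1 hP hQ n.
rewrite e mulrC mul_polyC actZl => /eqP; rewrite mulf_eq0 => /orP[|/eqP//].
rewrite -mulr_natr mulf_eq0 lead_coef_eq0 (negPf Q0) /=.
by case: (_`!) (fact_gt0 (size Q).-1) => // m _; rewrite (negPf (F0 m)).
Qed.

(** * Exponential polynomials in the binomial basis *)

Section ExponentialPolynomials.
Variable K : fieldType.
Implicit Types (u d : nat -> K) (x : K).

Lemma act_XsubC x u n : act ('X - x%:P) u n = u n.+1 - x * u n.
Proof. by rewrite actDl actNl actC -[X in act X]mul1r act_mulX act1. Qed.

(** By Pascal's rule [X - x] sends [x^m 'C(m, j)] to [x^(m+1) 'C(m, j-1)], so each factor lowers the
    degree by one. *)
Lemma act_exp_binomials x e d n :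
  act (('X - x%:P) ^+ e)
    (fun m => x ^+ m * \sum_(j < e) d j * 'C(m, j)%:R) n = 0.
Proof.
elim: e d n => [|e IH] d n; first by rewrite expr0 act1 big_ord0 mulr0.
rewrite exprSr actM -[RHS](IH (fun j => x * d j.+1) n); apply: eq_act => m.
rewrite act_XsubC big_ord_recl bin0 [X in _ - x * (_ * X)]big_ord_recl bin0.
rewrite exprS -!mulrA -mulrBr -mulrBr mulrCA opprD addrACA subrr add0r -sumrB.
congr (_ * _); rewrite mulr_sumr; apply: eq_bigr => j _.
by rewrite lift0 -mulrBr binS natrD addrAC subrr add0r mulrA.
Qed.

Lemma exp_binomials_of_act x e u : x != 0 ->
  (forall n, act (('X - x%:P) ^+ e) u n = 0) ->
  exists d, forall n, u n = x ^+ n * \sum_(j < e) d j * 'C(n, j)%:R.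
Proof.
move=> x0; elim: e u => [|e IH] u h.
  by exists (fun=> 0) => n; have := h n; rewrite expr0 act1 big_ord0 mulr0.
have [n|d hd] := IH (act ('X - x%:P) u); first by rewrite -actM -exprSr.
(* Discrete integration: the coefficients move up one binomial, divided by [x], and the initial
   value is the constant of integration. *)
exists (fun j => if j is j'.+1 then d j' / x else u 0%N).
elim=> [|n IHn].
  by rewrite big_ord_recl big1 ?mul1r ?bin0 ?mulr1 ?addr0 // => j _; rewrite mulr0.
have := hd n; rewrite act_XsubC => /eqP; rewrite subr_eq => /eqP ->.
rewrite IHn mulrA -exprS [X in x ^+ n * X + _](_ : _ =
    x * \sum_(j < e) d j / x * 'C(n, j)%:R); last first.
  by rewrite mulr_sumr; apply: eq_bigr => j _; rewrite mulrA mulrCA divff // mulr1.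
rewrite mulrA -exprSr -mulrDr; congr (_ * _).
rewrite !big_ord_recl !bin0 addrCA; congr (_ + _); rewrite -big_split.
by apply: eq_bigr => j _; rewrite !lift0 /= -mulrDr -natrD addnC -binS.
Qed.

(** A Bezout relation between [(X - x)^e] and the product over the other roots splits [u] into one
    part annihilated by each. *)
Lemma exp_poly_decomposition (rs : seq K) e u :
  uniq rs -> 0 \notin rs ->
  (forall n, act (\prod_(x <- rs) ('X - x%:P) ^+ e) u n = 0) ->
  exists c : nat -> nat -> K, forall n,
    u n = \sum_(i < size rs) rs`_i ^+ n * \sum_(j < e) c i j * 'C(n, j)%:R.
Proof.
elim: rs u => [|x rs IH] u.
  move=> _ _ h; exists (fun _ _ => 0) => n; rewrite big_ord0.
  by have := h n; rewrite big_nil act1.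
rewrite /= inE negb_or => /andP[xrs urs] /andP[x0 rs0].
rewrite big_cons eq_sym in x0 *.
set P1 := _ ^+ e; set P2 := \prod_(_ <- _) _ => h.
have cop : coprimep P1 P2.
  rewrite /P2 coprimep_sym; elim: (rs) xrs => [|y s IHs].
    by rewrite big_nil coprime1p.
  rewrite inE negb_or big_cons coprimepMl => /andP[xy /IHs ->].
  by rewrite andbT coprimep_expl // coprimep_expr // coprimep_XsubC root_XsubC.
have [[a b] /= ab] := Bezout_eq1_coprimepP _ _ cop.
have hu n : u n = act (b * P2) u n + act (a * P1) u n.
  by rewrite -actDl addrC ab act1.
have [m|d hd] := @exp_binomials_of_act x e (act (b * P2) u) x0.
  by rewrite -actM mulrCA act_dvd.
have [m|c hc] := IH (act (a * P1) u) urs rs0.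
  by rewrite -actM mulrCA -[P2 * P1]mulrC act_dvd.
exists (fun i => if i is i'.+1 then c i' else d) => n.
by rewrite hu hd hc big_ord_recl.
Qed.

Lemma act_exp_poly (rs : seq K) e (c : nat -> nat -> K) n :
  act (\prod_(x <- rs) ('X - x%:P) ^+ e)
    (fun m => \sum_(i < size rs) rs`_i ^+ m * \sum_(j < e) c i j * 'C(m, j)%:R) n = 0.
Proof.
rewrite act_sumr big1 // => i _.
rewrite (big_nth 0) big_mkord (bigD1 i) //= mulrC act_dvd // => m.
exact: act_exp_binomials.
Qed.

(** Since ['C(n+1, j+1) / (n+1) = 'C(n, j) / (j+1)], division by the index keeps an exponential
    polynomial whose constant coefficients vanish within the same class. *)
Lemma exp_poly_quotient_annihilated (rs : seq K) e (c : nat -> nat -> K) u :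
  (forall n, n.+1%:R != 0 :> K) ->
  (forall n, u n = \sum_(i < size rs) rs`_i ^+ n * \sum_(j < e) c i j * 'C(n, j)%:R) ->
  (forall i, (i < size rs)%N -> c i 0%N = 0) ->
  forall n, act (\prod_(x <- rs) ('X - x%:P) ^+ e) (fun m => u m.+1 / m.+1%:R) n = 0.
Proof.
move=> K0 hu c0 n.
pose c' i j := if (j < e.-1)%N then rs`_i * c i j.+1 / j.+1%:R else 0.
rewrite -[RHS](act_exp_poly rs e c' n); apply: eq_act => m.
rewrite hu mulr_suml; apply: eq_bigr => i _.
rewrite exprS -!mulrA mulrCA; congr (_ * _).
case: e @c' {hu} => [|e] c' /=; first by rewrite !big_ord0 mul0r mulr0.
rewrite big_ord_recl c0 // mul0r add0r [RHS]big_ord_recr /= /c' /= ltnn mul0r addr0.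
rewrite mulr_suml mulr_sumr; apply: eq_bigr => j _.
rewrite /bump /= add1n ltn_ord -!mulrA; congr (_ * (_ * _)).
apply/eqP; rewrite [eqbRHS]mulrC eqr_div // -!natrM.
by rewrite mulnC -mul_bin_diag mulnC.
Qed.

End ExponentialPolynomials.

(** * Algebraic integers modulo a prime *)

Section AlgebraicSubfield.
Variable C : numClosedFieldType.

Definition algebraic_pred : {pred C} := fun x => `[< algebraicOver ratr x >].

Fact algebraic_pred_divring : divring_closed algebraic_pred.
Proof.
split.
- exact/asboolP/algebraic1.
- by move=> x y /asboolP hx /asboolP hy; exact/asboolP/algebraic_sub.
- by move=> x y /asboolP hx /asboolP hy; exact/asboolP/algebraic_div.
Qed.

HB.instance Definition _ :=
  GRing.isDivringClosed.Build C algebraic_pred algebraic_pred_divring.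

(** Decomposing [u] inside the field of algebraic numbers makes its coefficients algebraic from the
    outset, so that they have denominators. *)
Definition alg_num := {x : C | x \in algebraic_pred}.
HB.instance Definition _ := [isSub of alg_num for @sval _ _].
HB.instance Definition _ := [Choice of alg_num by <:].
HB.instance Definition _ := [SubChoice_isSubIntegralDomain of alg_num by <:].
HB.instance Definition _ := [SubIntegralDomain_isSubField of alg_num by <:].
End AlgebraicSubfield.

Definition aint (K : nzRingType) (x : K) := integralOver (intr : int -> K) x.

Lemma aint_nat (K : nzRingType) n : aint (n%:R : K).
Proof. exact: integral_nat. Qed.

Lemma aint_int (K : nzRingType) (z : int) : aint (z%:~R : K).
Proof. exact: integral_id. Qed.

Lemma aintM (K : idomainType) (x y : K) : aint x -> aint y -> aint (x * y).
Proof. exact: integral_mul. Qed.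

Lemma aintD (K : idomainType) (x y : K) : aint x -> aint y -> aint (x + y).
Proof. exact: integral_add. Qed.

Lemma aintN (K : idomainType) (x : K) : aint x -> aint (- x).
Proof. exact: integral_opp. Qed.

Lemma aintX (K : idomainType) (x : K) n : aint x -> aint (x ^+ n).
Proof.
move=> hx; elim: n => [|n IH]; first exact: (aint_nat _ 1).
by rewrite exprS; exact: aintM.
Qed.

Lemma aint_horner (K : idomainType) (p : {poly int}) (x : K) :
  aint x -> aint (map_poly intr p).[x].
Proof.
by apply: integral_horner; apply/integral_poly => i; rewrite coef_map; exact: integral_id.
Qed.

Lemma aint_root (K : idomainType) (p : {poly int}) (x : K) :
  p \is monic -> root (map_poly intr p) x -> aint x.
Proof. by exists p. Qed.

(** The polynomial [l^(n-1) q(X / l)] is monic with integer coefficients and vanishes at [l x]. *)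
Lemma aint_multiple_root (K : idomainType) (q : {poly int}) (x : K) :
  q != 0 -> root (map_poly intr q) x -> aint ((lead_coef q)%:~R * x).
Proof.
move=> q0 qx; set l := lead_coef q; pose n := (size q).-1.
have sq : size q = n.+1 by rewrite polySpred.
(* In positive characteristic a nonzero constant may have a root: then [l] is zero in [K]. *)
have [n0|n0] := posnP n.
  have e : q = l%:P by rewrite /l lead_coefE sq n0; apply: size1_polyC; rewrite sq n0.
  move: qx; rewrite e map_polyC rootC /= => /eqP ->; rewrite mul0r.
  exact: (aint_nat _ 0).
pose p : {poly int} := 'X^n + \poly_(i < n) (q`_i * l ^+ (n.-1 - i)).
have sp : (size (\poly_(i < n) (q`_i * l ^+ (n.-1 - i)))%R < size ('X^n : {poly int})%R)%N.
  by rewrite size_polyXn ltnS size_poly.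
apply: (@aint_root _ p); first by rewrite monicE lead_coefDl // lead_coefXn.
rewrite /root rmorphD rmorphXn /= map_polyX hornerD hornerXn.
have e1 : map_poly intr (\poly_(i < n) (q`_i * l ^+ (n.-1 - i))) =
    \poly_(i < n) (q`_i * l ^+ (n.-1 - i))%:~R :> {poly K}.
  apply/polyP => i; rewrite coef_map !coef_poly.
  by case: ifP => // _; rewrite mulr0z.
move: qx; rewrite e1 horner_poly /root (horner_coef_wide (n := n.+1)); last first.
  by rewrite -sq size_poly.
rewrite big_ord_recr /= coef_map /= -[q`_n]/(lead_coef q) -/l => /eqP hx.
have e2 : \sum_(i < n) (q`_i * l ^+ (n.-1 - i))%:~R * (l%:~R * x) ^+ i =
    l%:~R ^+ n.-1 * \sum_(i < n) (map_poly intr q)`_i * x ^+ i.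
  rewrite mulr_sumr; apply: eq_bigr => i _; rewrite coef_map rmorphM rmorphXn /=.
  have hi : (i <= n.-1)%N by case: (i) => /= m; lia.
  by rewrite exprMn -[in RHS](subnK hi) exprD; ring.
rewrite e2 exprMn -[in X in X + _](prednK n0) [in X in X + _]exprSr (prednK n0) -mulrA -mulrDr.
by rewrite addrC hx mulr0.
Qed.

Lemma alg_num_denominator (C : numClosedFieldType) (x : alg_num C) :
  exists2 N : nat, (0 < N)%N & aint (N%:R * x).
Proof.
have /asboolP[p p0 px] := valP x.
have [q [l l0 e]] := rat_poly_scale p.
have q0 : q != 0 by apply: contraNneq p0 => q0; rewrite e q0 rmorph0 scaler0.
have qx : root (map_poly intr q) x.
  rewrite -(fmorph_root (val : {rmorphism alg_num C -> C})) -map_poly_comp /=.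
  move: px; rewrite e map_polyZ rootZ; last by rewrite fmorph_eq0 invr_eq0 intr_eq0.
  rewrite -map_poly_comp; congr (root _ _); apply: eq_map_poly => z /=.
  by rewrite ratr_int; apply/esym/(rmorph_int (val : {rmorphism alg_num C -> C})).
have := aint_multiple_root q0 qx; set z := lead_coef q => hz.
have z0 : z != 0 by rewrite lead_coef_eq0.
exists `|z|%N; first by rewrite absz_gt0.
have [z1|z1] := lerP 0 z.
  suff -> : `|z|%N%:R = z%:~R :> alg_num C by [].
  by rewrite pmulrn gez0_abs.
suff -> : `|z|%N%:R * x = - (z%:~R * x) by exact: aintN.
by rewrite -mulNr pmulrn ltz0_abs // mulrNz.
Qed.

(** * Congruences between algebraic integers *)

Section ModP.
Variables (K : fieldType) (p : nat).
Hypothesis K0 : forall n, n.+1%:R != 0 :> K.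
Hypothesis p_pr : prime p.
Implicit Types x y : K.

(* Congruences modulo [p] times the ring of algebraic integers: prime ideals are not needed,
   since [regular] elements can be cancelled. *)
Definition modp0 x := exists2 y, aint y & x = p%:R * y.

Lemma modp0D x y : modp0 x -> modp0 y -> modp0 (x + y).
Proof.
move=> [x' hx ->] [y' hy ->]; exists (x' + y'); first exact: aintD.
by rewrite mulrDr.
Qed.

Lemma modp0N x : modp0 x -> modp0 (- x).
Proof.
by move=> [x' hx ->]; exists (- x'); [exact: aintN | rewrite mulrN].
Qed.

Lemma modp0M x y : aint x -> modp0 y -> modp0 (x * y).
Proof.
by move=> hx [y' hy ->]; exists (x * y'); [exact: aintM | rewrite mulrCA].
Qed.

Lemma modp0_0 : modp0 0.
Proof. by exists 0; [exact: (aint_nat _ 0) | rewrite mulr0]. Qed.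

Lemma modp0_sum (I : Type) (r : seq I) (P : pred I) (F : I -> K) :
  (forall i, P i -> modp0 (F i)) -> modp0 (\sum_(i <- r | P i) F i).
Proof. by move=> h; apply: big_ind => //; [exact: modp0_0 | exact: modp0D]. Qed.

Lemma modp0_dvd (z : int) : (p%:Z %| z)%Z -> modp0 z%:~R.
Proof.
move=> /dvdzP[q ->]; exists q%:~R; first exact: aint_int.
by rewrite intrM mulrC.
Qed.

Lemma modp0_dvdn n : (p %| n)%N -> modp0 n%:R.
Proof. by move=> h; rewrite pmulrn; exact: modp0_dvd. Qed.

Definition regular x := forall y, aint y -> modp0 (x * y) -> modp0 y.

Lemma regular_nat n : ~~ (p %| n)%N -> regular n%:R.
Proof.
move=> pn y hy hny.
have n0 : (0 < n)%N by case: (n) pn; rewrite ?dvdn0.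
have cop : coprime n p by rewrite coprime_sym prime_coprime.
have [a b e _] := egcdnP p n0; rewrite (eqP cop) in e.
have -> : y = a%:R * (n%:R * y) - b%:R * p%:R * y.
  by rewrite mulrA -natrM e natrD natrM; ring.
apply: modp0D; first by apply: modp0M => //; exact: aint_nat.
apply: modp0N; exists (b%:R * y); first by apply: aintM => //; exact: aint_nat.
by ring.
Qed.

Lemma regular_dvd x y n : aint y -> n%:R = x * y -> ~~ (p %| n)%N -> regular x.
Proof.
move=> hy e pn z hz hxz; apply: (regular_nat pn hz).
by rewrite e mulrAC mulrC; exact: modp0M.
Qed.

Lemma regularX x m : aint x -> regular x -> regular (x ^+ m).
Proof.
move=> hx rx; elim: m => [|m IH] y hy; first by rewrite expr0 mul1r.
rewrite exprS -mulrA => h; apply: IH => //; apply: rx => //.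
by apply: aintM => //; exact: aintX.
Qed.

(** The inner binomial coefficients are divisible by [p]. The sign of the last term is right for odd
    [p], and for [p = 2] the discrepancy [2 y ^ 2] vanishes modulo 2. *)
Lemma frobenius_modp0 x y : aint x -> aint y ->
  modp0 ((x - y) ^+ p - (x ^+ p - y ^+ p)).
Proof.
move=> hx hy; have p0 := prime_gt0 p_pr.
have p1 := prime_gt1 p_pr.
rewrite exprBn.
rewrite -(big_mkord xpredT (fun i => ((-1) ^+ i * x ^+ (p - i) * y ^+ i) *+ 'C(p, i))).
rewrite big_ltn // big_nat_recr //= subn0 subnn.
rewrite !expr0 bin0 binn !mul1r !mulr1 !mulr1n.
set S := \sum_(1 <= i < p) _.
have hS : modp0 S.
  rewrite /S big_nat; apply: modp0_sum => i hi; rewrite -mulr_natr.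
  apply: modp0M; last by apply: modp0_dvdn; exact: prime_dvd_bin.
  apply: aintM; last exact: aintX.
  apply: aintM; last exact: aintX.
  by apply: aintX; exact: (aint_int _ (-1)).
have -> : x ^+ p + (S + (-1) ^+ p * y ^+ p) - (x ^+ p - y ^+ p) =
    S + ((-1) ^+ p + 1) * y ^+ p by ring.
apply: modp0D => //; rewrite mulrC; apply: modp0M; first exact: aintX.
case: (even_prime p_pr) => [p2|p_odd].
  exists 1; first exact: (aint_nat _ 1).
  by rewrite p2 expr2 mulrNN !mulr1.
by rewrite -signr_odd p_odd expr1 addNr; exact: modp0_0.
Qed.

Lemma intr_char0_eq0 (z : int) : (z%:~R == 0 :> K) = (z == 0).
Proof.
have h n : (n%:R == 0 :> K) = (n == 0%N) by case: n => [|n]; rewrite ?eqxx // (negPf (K0 n)).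
case: z => n; first by rewrite -pmulrn h.
by rewrite NegzE mulrNz oppr_eq0 -pmulrn h.
Qed.

(** A monic integer equation of degree [n] for [1 / p], multiplied by [p ^ n], has leading term 1
    and all other terms divisible by [p]. *)
Lemma modp0_1 : ~ modp0 1.
Proof.
move=> [y [q q_mon qy] e].
set n := (size q).-1.
have sq : size q = n.+1 by rewrite /n prednK // size_poly_gt0 monic_neq0.
have : (\sum_(i < n.+1) q`_i * p%:Z ^+ (n - i))%:~R == 0 :> K.
  have e0 : p%:R ^+ n * (map_poly intr q).[y] = 0 by rewrite (rootP qy) mulr0.
  rewrite -[X in _ == X]e0 (horner_coef_wide (n := n.+1)); last first.
    by rewrite -sq size_poly.
  rewrite mulr_sumr rmorph_sum; apply/eqP/eq_bigr => i _.
  rewrite coef_map rmorphM rmorphXn /= -pmulrn.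
  have hi : (i <= n)%N by rewrite -ltnS.
  have -> : (p%:R : K) ^+ n = p%:R ^+ (n - i) * p%:R ^+ i by rewrite -exprD subnK.
  by rewrite mulrCA -!mulrA -exprMn -e expr1n mulr1.
rewrite intr_char0_eq0 big_ord_recr /= subnn expr0 mulr1 addrC.
have -> : q`_n = 1 by move/monicP: q_mon.
rewrite addr_eq0 => /eqP h1.
have : (p%:Z %| 1%R)%Z.
  rewrite h1 rpredN; apply: (big_ind (fun z : int => (p%:Z %| z)%Z)) => //.
    by move=> a b; exact: rpredD.
  by move=> i _; apply: dvdz_mull; rewrite -(subnSK (ltn_ord i)) exprS dvdz_mulr.
by rewrite dvdzE /= dvdn1 => /eqP p1; move: p_pr; rewrite p1.
Qed.
End ModP.

(** * Small integer multiples of differences of powers of roots *)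

Section IntegerMultiple.

(** Majorization is stable under sums and products, so the coefficients of a determinant can be
    bounded by those of an explicit polynomial. *)
Definition dominated (p q : {poly int}) := forall i, `|p`_i| <= q`_i.

Lemma dominatedD p1 q1 p2 q2 :
  dominated p1 q1 -> dominated p2 q2 -> dominated (p1 + p2) (q1 + q2).
Proof.
by move=> h1 h2 i; rewrite !coefD; apply: le_trans (ler_normD _ _) _; exact: lerD.
Qed.

Lemma dominatedM p1 q1 p2 q2 :
  dominated p1 q1 -> dominated p2 q2 -> dominated (p1 * p2) (q1 * q2).
Proof.
move=> h1 h2 i; rewrite !coefM; apply: le_trans (ler_norm_sum _ _ _) _.
by apply: ler_sum => j _; rewrite normrM; apply: ler_pM.
Qed.

(** The Leibniz expansion has [n!] products of [n] entries, each entry dominated by [X + H]. *)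
Lemma dominated_char_poly n (A : 'M[int]_n) (H : nat) :
  (forall i j, `|A i j| <= H%:Z) ->
  dominated (char_poly A) (('X + H%:Z%:P) ^+ n *+ n`!).
Proof.
move=> hA; rewrite /char_poly /determinant.
have -> : ('X + H%:Z%:P : {poly int}) ^+ n *+ n`! =
    \sum_(s : 'S_n) \prod_(i < n) ('X + H%:Z%:P).
  by rewrite prodr_const card_ord sumr_const card_Sn.
apply: (big_ind2 dominated); first by move=> i; rewrite coef0 normr0.
  by move=> *; exact: dominatedD.
move=> s _ i.
rewrite -signr_odd; set b := odd _.
have -> : `|((-1) ^+ b * \prod_(i0 < n) char_poly_mx A i0 (s i0))`_i| =
    `|(\prod_(i0 < n) char_poly_mx A i0 (s i0))`_i|.
  by case: b; rewrite ?expr0 ?expr1 ?mulN1r ?mul1r ?coefN ?normrN.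
move: i; apply: (big_ind2 dominated).
- by move=> i; rewrite coef1; case: (i == 0%N).
- by move=> *; exact: dominatedM.
move=> j _ i; rewrite !mxE coefB coefD coefMn coefX !coefC.
apply: le_trans (ler_normB _ _) _; apply: lerD.
  by case: (_ == _); case: (_ == _).
by case: (_ == _); rewrite ?hA ?normr0.
Qed.

Lemma dominated_coef_le p q i : dominated p q -> `|p`_i| <= q.[1].
Proof.
move=> h; have q0 j : 0 <= q`_j by apply: le_trans (h j).
apply: le_trans (h i) _; have [hi|hi] := ltnP i (size q); last first.
  rewrite nth_default // horner_coef; apply: sumr_ge0 => j _.
  by rewrite expr1n mulr1.
rewrite horner_coef (bigD1 (Ordinal hi)) //= expr1n mulr1 lerDl.
by apply: sumr_ge0 => j _; rewrite expr1n mulr1.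
Qed.

Variable K : fieldType.

(* The lowest nonzero coefficient of the characteristic polynomial is a multiple of
   every nonzero eigenvalue; no information on the other eigenvalues is needed. *)
Lemma eigenvalue_integer_multiple n (A : 'M[int]_n) (H : nat) (x : K) :
  (forall i j, `|A i j| <= H%:Z) ->
  eigenvalue (map_mx intr A) x -> x != 0 ->
  exists2 N : nat, (0 < N <= H.+1 ^ n * n`!)%N & exists2 y, aint y & N%:R = x * y.
Proof.
move=> hA; rewrite eigenvalue_root_char -map_char_poly => qx x0.
set q := char_poly A in qx.
have xi : aint x := aint_root (char_poly_monic A) qx.
have q_ex : exists i, q`_i != 0.
  exists (size q).-1; rewrite -lead_coefE; have := char_poly_monic A.
  by rewrite -/q => /monicP ->.
have [t qt tmin] := ex_minnP q_ex.
have bound : `|q`_t| <= (H.+1 ^ n * n`!)%N%:Z.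
  apply: le_trans (dominated_coef_le t (dominated_char_poly hA)) _.
  rewrite hornerMn horner_exp hornerD hornerX hornerC -mulr_natr.
  by rewrite -[leRHS]natz natrM natrX -natr1 addrC natz.
have low : map_poly intr q = (q`_t)%:~R *: 'X^t +
    map_poly intr (drop_poly t.+1 q) * 'X^(t.+1) :> {poly K}.
  rewrite -[in LHS](poly_take_drop t.+1 q) rmorphD rmorphM /= map_polyXn.
  congr (_ + _); apply/polyP => i; rewrite coef_map coef_take_poly coefZ coefXn /=.
  rewrite ltnS; have [->|it] := eqVneq i t; first by rewrite leqnn mulr1.
  rewrite mulr0; have [hi|//] := leqP i t; have [->//|/tmin] := eqVneq q`_i 0.
  by rewrite leqNgt ltn_neqAle it hi.
pose d := (map_poly intr (drop_poly t.+1 q)).[x] : K.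
have di : aint d by exact: aint_horner.
have ed : (q`_t)%:~R = - (x * d).
  move/rootP: qx; rewrite low hornerD hornerZ hornerM !hornerXn -/d => e0.
  have /eqP : x ^+ t * ((q`_t)%:~R + x * d) = 0 by rewrite -[RHS]e0 exprS; ring.
  by rewrite mulf_eq0 expf_eq0 (negPf x0) andbF /= addr_eq0 => /eqP.
exists (absz q`_t).
  by rewrite absz_gt0 qt -lez_nat abszE.
have [z1|z1] := lerP 0 q`_t.
  exists (- d); first exact: aintN.
  by rewrite mulrN -ed pmulrn gez0_abs.
by exists d => //; rewrite pmulrn ltz0_abs // mulrNz ed opprK.
Qed.

Lemma eigen_integer_multiple (I : finType) (T : I -> I -> int) (H : nat)
    (w : I -> K) (i0 : I) (x : K) :
  (forall i j, `|T i j| <= H%:Z) -> w i0 != 0 ->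
  (forall i, x * w i = \sum_j (T i j)%:~R * w j) -> x != 0 ->
  exists2 N : nat, (0 < N <= H.+1 ^ #|I| * (#|I|)`!)%N &
    exists2 y, aint y & N%:R = x * y.
Proof.
move=> hT w0 hw x0.
(* Eigenvectors are rows in [eigenvalue], hence the transposition. *)
pose A : 'M[int]_#|I| := \matrix_(i, j) T (enum_val j) (enum_val i).
apply: (@eigenvalue_integer_multiple _ A); first by move=> i j; rewrite mxE.
  apply/eigenvalueP; exists (\row_i w (enum_val i)).
    apply/rowP => i; rewrite !mxE hw [RHS](reindex_onto enum_val enum_rank) /=.
      rewrite [RHS](eq_bigl xpredT); last by move=> j; rewrite enum_valK eqxx.
      by apply: eq_bigr => j _; rewrite !mxE mulrC.
    by move=> j _; rewrite enum_rankK.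
  apply: contraNneq w0 => /rowP/(_ (enum_rank i0)).
  by rewrite !mxE enum_rankK => ->.
exact: x0.
Qed.

Section Companion.
Variables (P : {poly int}) (k : nat).
Hypothesis P_mon : P \is monic.
Hypothesis sP : size P = k.+2.

(** The companion matrix, oriented so that [(1, x, ..., x^k)] is a column eigenvector for each root
    [x]. *)
Let M : 'M[int]_k.+1 :=
  \matrix_(i, j) if (i < k)%N then (j == i.+1 :> nat)%:R else - P`_j.

Let H := (\sum_(i < size P) absz (P`_i)%R)%N.

Let H_gt0 : (0 < H)%N.
Proof.
have hk : (k.+1 < size P)%N by rewrite sP.
have P1 : P`_k.+1 = 1 by move/monicP: P_mon; rewrite lead_coefE sP.
by rewrite /H (bigD1 (Ordinal hk)) //= P1.
Qed.

Let M_le i j : `|M i j| <= H%:Z.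
Proof.
rewrite mxE -abszE lez_nat; case: ifP => _; last first.
  have hj : (j < size P)%N by rewrite sP; apply: leq_trans (ltn_ord j) _.
  by rewrite abszN /H (bigD1 (Ordinal hj)) //= leq_addr.
have := H_gt0.
by case: (_ == _).
Qed.

Let M_pow_le d i j : `|(M ^+ d) i j| <= ((k.+1 * H) ^ d)%N%:Z.
Proof.
elim: d i j => [|d IH] i j; first by rewrite expr0 mxE; case: (_ == _).
rewrite exprS mxE; apply: le_trans (ler_norm_sum _ _ _) _.
have -> : ((k.+1 * H) ^ d.+1)%N%:Z =
    \sum_(i < k.+1) (H%:Z * ((k.+1 * H) ^ d)%N%:Z).
  by rewrite sumr_const card_ord -mulr_natr natz -!PoszM expnS; congr Posz; ring.
by apply: ler_sum => l _; rewrite normrM; apply: ler_pM.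
Qed.

Let M_eigen (x : K) i : root (map_poly intr P) x ->
  \sum_j (M i j)%:~R * x ^+ j = x * x ^+ i.
Proof.
move=> Px; have [ik|ik] := ltnP i k.
  have hi : (i.+1 < k.+1)%N by [].
  rewrite (bigD1 (Ordinal hi)) //= mxE ik eqxx mul1r exprS big1 ?addr0 // => j ji.
  rewrite mxE ik; have -> : (j == i.+1 :> nat) = false by apply/negbTE.
  by rewrite mul0r.
have -> : x * x ^+ i = x ^+ k.+1.
  by rewrite -exprS; congr (_ ^+ _); have := ltn_ord i; lia.
move/rootP: Px; rewrite (horner_coef_wide (n := k.+2)); last by rewrite -sP size_poly.
rewrite big_ord_recr /= coef_map /=.
have -> : P`_k.+1 = 1 by move/monicP: P_mon; rewrite lead_coefE sP.
rewrite mul1r => /eqP; rewrite addrC addr_eq0 => /eqP ->; rewrite -sumrN.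
apply: eq_bigr => j _; rewrite mxE ltnNge ik /= coef_map /=.
by rewrite mulrNz mulNr.
Qed.

Let M_pow_eigen d (x : K) i : root (map_poly intr P) x ->
  \sum_j ((M ^+ d) i j)%:~R * x ^+ j = x ^+ d * x ^+ i.
Proof.
move=> Px; elim: d i => [|d IH] i.
  rewrite expr0 mul1r (bigD1 i) //= mxE eqxx mul1r big1 ?addr0 // => j ji.
  by rewrite mxE eq_sym (negPf ji) mul0r.
rewrite exprS [x ^+ _]exprSr -mulrA -M_eigen // mulr_sumr.
under eq_bigr do rewrite mxE rmorph_sum mulr_suml.
rewrite exchange_big; apply: eq_bigr => j _.
rewrite mulrCA -IH mulr_sumr.
by apply: eq_bigr => l _; rewrite rmorphM mulrA.
Qed.

(* The integer matrix [M^d (x) 1 - 1 (x) M^d] has the eigenvector [alpha^i beta^j]. *)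
Lemma root_pow_sub_multiple : exists C : nat, forall (alpha beta : K) d,
  root (map_poly intr P) alpha -> root (map_poly intr P) beta ->
  (0 < d)%N -> alpha ^+ d != beta ^+ d ->
  exists2 N : nat, (0 < N <= 2 ^ (C * d))%N &
    exists2 y, aint y & N%:R = (alpha ^+ d - beta ^+ d) * y.
Proof.
pose I : finType := ('I_k.+1 * 'I_k.+1)%type.
pose n := #|I|.
(* For [B = k.+1 * H] the entries of [T] are at most [2 B^d], and
   [2 B^d + 1 <= (3 B)^d <= 2 ^ (3 B d)]; the summand [n!] of the exponent accounts for the
   factorial. *)
exists (n * (3 * (k.+1 * H)) + n`!)%N => alpha beta d ra rb d0 hab.
pose T (a b : I) : int := (M ^+ d) a.1 b.1 * (a.2 == b.2)%:R
  - (M ^+ d) a.2 b.2 * (a.1 == b.1)%:R.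
pose w (a : I) := alpha ^+ a.1 * beta ^+ a.2.
have [||||N /andP[N0 hN] hy] := @eigen_integer_multiple I T (2 * (k.+1 * H) ^ d)
    w (ord0, ord0) (alpha ^+ d - beta ^+ d).
- move=> a b; apply: le_trans (ler_normB _ _) _.
  rewrite mul2n -addnn PoszD.
  apply: lerD; apply: le_trans (M_pow_le d _ _); rewrite normrM.
    by case: (_ == _); rewrite ?mulr0 ?mulr1.
  by case: (_ == _); rewrite ?mulr0 ?mulr1.
- by rewrite /w /= !expr0 mulr1 oner_eq0.
- case=> a b; rewrite /w /T /= mulrBl.
  under eq_bigr do rewrite rmorphB mulrBl.
  rewrite sumrB; congr (_ - _).
    rewrite -(pair_bigA _ (fun i j => ((M ^+ d) a i * (b == j)%:R)%:~R
      * (alpha ^+ i * beta ^+ j))) /= mulrA -(M_pow_eigen d a ra) mulr_suml.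
    apply: eq_bigr => i _; rewrite (bigD1 b) //= eqxx mulr1 mulrA big1 ?addr0 //.
    by move=> j jb; rewrite eq_sym (negPf jb) mulr0 mul0r.
  rewrite -(pair_bigA _ (fun i j => ((M ^+ d) b j * (a == i)%:R)%:~R
    * (alpha ^+ i * beta ^+ j))) /= exchange_big /= mulrCA.
  rewrite -(M_pow_eigen d b rb) mulr_sumr.
  apply: eq_bigr => j _; rewrite (bigD1 a) //= eqxx mulr1 mulrCA big1 ?addr0 //.
  by move=> i ia; rewrite eq_sym (negPf ia) mulr0 mul0r.
- by rewrite subr_eq0.
exists N => //; rewrite N0; apply: leq_trans hN _.
rewrite -/n mulnDl expnD; apply: leq_mul; last first.
  apply: leq_trans (ltnW (ltn_expl _ (ltnSn 1))) _.
  by rewrite leq_exp2l // leq_pmulr.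
have n0 : (0 < n)%N by apply/card_gt0P; exists (ord0, ord0).
set B := (k.+1 * H)%N; have B0 : (0 < B)%N by rewrite muln_gt0.
rewrite -[X in (_ <= 2 ^ X)%N]mulnA [X in (_ <= 2 ^ X)%N]mulnC expnM.
rewrite leq_exp2r // expnM.
apply: (@leq_trans ((3 * B) ^ d)); last by rewrite leq_exp2r // ltnW // ltn_expl.
rewrite expnMn; apply: (@leq_trans (3 * B ^ d)).
  by have := expn_gt0 B d; rewrite B0 /=; lia.
by rewrite leq_mul2r orbC -[leqLHS]expn1 leq_exp2l // d0.
Qed.
End Companion.
End IntegerMultiple.

(** * Zeros of power sums modulo a prime *)

Section FewZeros.
Variables (K : fieldType) (p : nat).

(* Two relations at [m] and [m + d] eliminate the last term. *)
Lemma few_zeros r (gam b : nat -> K) (Z : pred nat) s L :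
  (forall i, (i < r)%N -> aint (gam i)) ->
  (forall i, (i < r)%N -> aint (b i)) ->
  (forall i, (i < r)%N -> regular p (gam i)) ->
  (forall i j d, (i < r)%N -> (j < r)%N -> i != j -> (0 < d < L)%N ->
    regular p (gam i ^+ d - gam j ^+ d)) ->
  (forall m, Z m -> modp0 p (\sum_(i < r) b i * gam i ^+ m)) ->
  ((4 * L) ^ (2 ^ r).-1 < count Z (iota s L) ^ (2 ^ r))%N ->
  forall i, (i < r)%N -> modp0 p (b i).
Proof.
elim: r b Z => // r IH b Z ag ab rg rgg hZ; rewrite expnS => hN.
have [d dL hd] := dense_shift (expn_gt0 2 r) hN.
have hb i : (i < r)%N -> modp0 p (b i).
  move=> ir; have ir1 := ltnW ir : (i < r.+1)%N.
  have irr : i != r by rewrite neq_ltn ir.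
  apply: (rgg i r d) => //; first exact: ab.
  rewrite mulrC.
  apply: (IH (fun i => b i * (gam i ^+ d - gam r ^+ d)) _ _ _ _ _ _ hd i ir).
  - by move=> j jr; apply: ag; rewrite ltnW.
  - move=> j jr; apply: aintM; first by apply: ab; rewrite ltnW.
    by apply: aintD; [|apply: aintN]; apply: aintX; apply: ag => //; rewrite ltnW.
  - by move=> j jr; apply: rg; rewrite ltnW.
  - by move=> j l e jr lr; apply: rgg; rewrite ltnW.
  move=> m /andP[/hZ h1 /hZ h2].
  have -> : \sum_(j < r) b j * (gam j ^+ d - gam r ^+ d) * gam j ^+ m =
      \sum_(j < r.+1) b j * gam j ^+ (m + d)
      - gam r ^+ d * \sum_(j < r.+1) b j * gam j ^+ m.
    rewrite mulr_sumr -sumrB big_ord_recr /= [X in _ + X](_ : _ = 0) ?addr0.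
      by apply: eq_bigr => j _; rewrite exprD; ring.
    by rewrite exprD; ring.
  apply: modp0D => //; apply: modp0N; apply: modp0M => //.
  by apply: aintX; apply: ag.
move=> i; rewrite ltnS leq_eqVlt => /orP[/eqP->|]; last exact: hb.
(* Once the other coefficients vanish modulo [p], a single zero [m] isolates the last one. *)
have /hasP[m _ Zm] : has Z (iota s L).
  rewrite has_count lt0n; apply: contraTneq hN => ->.
  by rewrite exp0n // muln_gt0 expn_gt0.
have rr : (r < r.+1)%N by [].
apply: (regularX (m := m) (ag r rr) (rg r rr) (ab r rr)).
have -> : gam r ^+ m * b r =
    \sum_(j < r.+1) b j * gam j ^+ m - \sum_(j < r) b j * gam j ^+ m.
  by rewrite big_ord_recr /= addrAC subrr add0r mulrC.
apply: modp0D; first exact: hZ.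
apply: modp0N; apply: modp0_sum => j _; rewrite mulrC; apply: modp0M; last exact: hb.
by apply: aintX; apply: ag; exact: (ltnW (ltn_ord j)).
Qed.
End FewZeros.

(** * Roots and denominators in the field of algebraic numbers *)

Lemma dvdp_prod_undup (K : fieldType) (s : seq K) :
  \prod_(x <- s) ('X - x%:P) %| \prod_(x <- undup s) ('X - x%:P) ^+ size s.
Proof.
rewrite -big_undup_iterop_count.
apply: (big_ind2 (fun p q : {poly K} => p %| q)) => //.
  by move=> *; exact: dvdp_mul.
move=> x _; exact: (dvdp_exp2l ('X - x%:P) (count_size (pred1 x) s)).
Qed.

Lemma prime_dvd_bin_multiple p m j : prime p -> (0 < j < p)%N -> (p %| 'C(p * m, j))%N.
Proof.
move=> p_pr; case: j => // j /= hj.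
have h : (p %| j.+1 * 'C(p * m, j.+1))%N by rewrite -mul_bin_diag -mulnA dvdn_mulr.
by move: h; rewrite Euclid_dvdM // gtnNdvd.
Qed.

Lemma alg_num_char0 (C : numClosedFieldType) n : n.+1%:R != 0 :> alg_num C.
Proof.
rewrite -(fmorph_eq0 (val : {rmorphism alg_num C -> C})) rmorph_nat.
by rewrite pnatr_eq0.
Qed.

Lemma alg_num_lift (C : numClosedFieldType) (P : {poly int}) (x : C) :
  P != 0 -> root (map_poly intr P) x -> exists y : alg_num C, val y = x.
Proof.
move=> P0 Px.
have xa : x \in @algebraic_pred C.
  apply/asboolP; exists (map_poly intr P).
    by rewrite map_poly_eq0_id0 // intr_eq0 lead_coef_eq0.
  rewrite -map_poly_comp; move: Px; congr (root _ _); apply: eq_map_poly => z /=.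
  by rewrite ratr_int.
by exists (Sub x xa); rewrite SubK.
Qed.

Lemma alg_num_split (C : numClosedFieldType) (P : {poly int}) : P \is monic ->
  exists2 s : seq (alg_num C), size s = (size P).-1 &
    map_poly intr P = \prod_(x <- s) ('X - x%:P).
Proof.
move=> P_mon; have [s hs] := closed_field_poly_normal (map_poly intr P : {poly C}).
have P0 := monic_neq0 P_mon.
have sP : size (map_poly intr P : {poly C}) = size P.
  by rewrite size_map_poly_id0 // (monicP P_mon) intr_eq0.
have lP : lead_coef (map_poly intr P : {poly C}) = 1.
  by rewrite lead_coef_map_eq (monicP P_mon) ?oner_eq0.
rewrite lP scale1r in hs.
have /(@choice _ _) [f hf] : forall x : C, exists y : alg_num C, x \in s -> val y = x.
  move=> x; have [xs|] := boolP (x \in s); last by exists 0.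
  have [|y hy] := @alg_num_lift C P x P0; last by exists y.
  by rewrite hs root_prod_XsubC.
exists (map f s).
  by rewrite size_map -sP hs size_prod_XsubC.
apply: (map_poly_inj (val : {rmorphism alg_num C -> C})).
rewrite -map_poly_comp map_prod_XsubC big_map.
rewrite (eq_map_poly (rmorph_int (val : {rmorphism alg_num C -> C}))) hs !big_seq.
apply: eq_bigr => x xs.
by rewrite /= hf.
Qed.

Lemma common_denominator (C : numClosedFieldType) (r k : nat) (c : nat -> nat -> alg_num C) :
  exists2 D : nat, (0 < D)%N &
    forall i j, (i < r)%N -> (j < k)%N -> aint (D%:R * c i j).
Proof.
have /(@choice _ _) [f hf] : forall ij : nat * nat, exists N : nat,
    (0 < N)%N /\ aint (N%:R * c ij.1 ij.2).
  by move=> [i j]; have [N] := alg_num_denominator (c i j); exists N.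
exists (\prod_(i < r) \prod_(j < k) f (i : nat, j : nat))%N.
  by apply: prodn_gt0 => i; apply: prodn_gt0 => j; case: (hf (i : nat, j : nat)).
move=> i j ir jk; rewrite (bigD1 (Ordinal ir)) //= (bigD1 (Ordinal jk)) //=.
rewrite [X in X%:R](_ : _ = (\prod_(j0 < k | j0 != Ordinal jk) f (i, j0 : nat) *
   \prod_(i0 < r | i0 != Ordinal ir) \prod_(j0 < k) f (i0 : nat, j0 : nat)) * f (i, j))%N; last first.
  by rewrite mulnC mulnA mulnC mulnA.
by rewrite natrM -mulrA; apply: aintM; [exact: aint_nat | case: (hf (i, j))].
Qed.

Lemma root_dvd_const_coef (K : fieldType) (P : {poly int}) (x : K) :
  P \is monic -> root (map_poly intr P) x ->
  exists2 y, aint y & (absz P`_0)%:R = x * y.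
Proof.
move=> P_mon Px; have xi := aint_root P_mon Px.
pose d := (map_poly intr (drop_poly 1 P)).[x] : K.
have di : aint d by exact: aint_horner.
have ed : (P`_0)%:~R = - (x * d).
  have : (map_poly intr P).[x] = (P`_0)%:~R + d * x.
    rewrite -[in LHS](poly_take_drop 1 P) rmorphD rmorphM /= map_polyXn expr1.
    rewrite hornerD hornerMX; congr (_ + _).
    have -> : take_poly 1 P = (P`_0)%:P.
      by apply/polyP => i; rewrite coef_take_poly coefC; case: i.
    by rewrite map_polyC hornerC.
  by rewrite (rootP Px) => /esym/eqP; rewrite addr_eq0 mulrC => /eqP.
have [z1|z1] := lerP 0 P`_0.
  exists (- d); first exact: aintN.
  by rewrite mulrN -ed pmulrn gez0_abs.
by exists d => //; rewrite pmulrn ltz0_abs // mulrNz ed opprK.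
Qed.

(** * Zeros of the recurrence modulo primes *)

Section KeyProposition.
Variables (C : numClosedFieldType) (P : {poly int}) (u : nat -> int).
Hypothesis P_mon : P \is monic.
Hypothesis P0 : P`_0 != 0.
Hypothesis sP : (1 < size P)%N.
Hypothesis Pu : forall n, act P u n = 0.
Hypothesis nondeg : forall x y : C, root (map_poly intr P) x ->
  root (map_poly intr P) y -> x != y -> forall d, (0 < d)%N -> x ^+ d != y ^+ d.
Hypothesis not_linrec : ~ exists2 Q : {poly C}, Q \is monic &
  forall n, act Q (fun m => (u m.+1)%:~R / m.+1%:R) n = 0.

Let K := alg_num C.
Let vK := (val : {rmorphism K -> C}).
Let K0 : forall n, n.+1%:R != 0 :> K := @alg_num_char0 C.

(** If every [c i 0] were zero, [exp_poly_quotient_annihilated] would make the image of [Q] a monic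
    annihilator of [u_(n+1) / (n+1)], against [not_linrec]. In [Q] every root has exponent [size s],
    which exceeds or equals its multiplicity in [P]. *)
Lemma exp_poly_form : exists (rs : seq K) (k : nat) (c : nat -> nat -> K),
  [/\ uniq rs, forall x, x \in rs -> root (map_poly intr P) x,
    forall n, (u n)%:~R = \sum_(i < size rs) rs`_i ^+ n * \sum_(j < k.+1) c i j * 'C(n, j)%:R
    & exists2 i, (i < size rs)%N & c i 0%N != 0].
Proof.
have [s ss hs] := alg_num_split C P_mon.
pose rs := undup s; pose k := size s.
have [k' kk'] : exists k', k = k'.+1.
  by exists k.-1; rewrite prednK // /k ss; lia.
have rsP x : x \in rs -> root (map_poly intr P) x.
  by rewrite mem_undup hs root_prod_XsubC.
have rs0 : 0 \notin rs.
  apply/negP => /rsP; rewrite /root horner_coef0 coef_map /= intr_char0_eq0 //.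
  by rewrite (negPf P0).
pose Q : {poly K} := \prod_(x <- rs) ('X - x%:P) ^+ k.
have hQ n : act Q (fun m => (u m)%:~R) n = 0.
  have /dvdpP[q ->] : map_poly intr P %| Q by rewrite hs; exact: dvdp_prod_undup.
  by apply: act_dvd => m; rewrite act_map Pu rmorph0.
have [c hc] := exp_poly_decomposition (undup_uniq s) rs0 hQ.
exists rs, k', c; split; rewrite -?kk' //; first exact: undup_uniq.
apply: contrapT => none; apply: not_linrec.
exists (map_poly vK Q).
  by rewrite map_monic monic_prod // => x _; apply: monic_exp; exact: monicXsubC.
have c0 i : (i < size rs)%N -> c i 0%N = 0.
  by move=> ir; apply/eqP; apply: contrapT => /negP ci; apply: none; exists i.
have h := exp_poly_quotient_annihilated K0 hc c0.
move=> n; rewrite -[RHS](rmorph0 vK) -(h n) -act_map; apply: eq_act => m.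
by rewrite fmorph_div rmorph_int rmorph_nat.
Qed.

(** [E L] is the product, over all pairs of roots and all [d < L], of the multiples from
    [root_pow_sub_multiple]: at most [r * r * L] factors, each at most [2 ^ (A * L)]. *)
Lemma pow_sub_multiples (rs : seq K) :
  uniq rs -> (forall x, x \in rs -> root (map_poly intr P) x) ->
  exists (A : nat) (E : nat -> nat),
    (forall L, (0 < E L <= 2 ^ (A * L ^ 2))%N) /\
    (forall p L i j d, prime p -> ~~ (p %| E L)%N -> (i < size rs)%N -> (j < size rs)%N ->
      i != j -> (0 < d < L)%N -> regular p (rs`_i ^+ d - rs`_j ^+ d)).
Proof.
move=> urs rsP; set r := size rs.
have [k sk] : exists k, size P = k.+2.
  by exists (size P).-2; move: sP; case: (size P) => [|[]].
have [A hA] := root_pow_sub_multiple K P_mon sk.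
pose ok (x : nat * nat * nat) := [&& x.1.1 < r, x.1.2 < r, x.1.1 != x.1.2 & 0 < x.2]%N.
have /(@choice _ _) [N hN] : forall x : nat * nat * nat, exists N : nat,
    [/\ (0 < N)%N, ok x -> (N <= 2 ^ (A * x.2))%N &
      ok x -> exists2 y, aint y & N%:R = (rs`_x.1.1 ^+ x.2 - rs`_x.1.2 ^+ x.2) * y].
  move=> [[i j] d]; have [|nok] := boolP (ok (i, j, d)); last first.
    (* Outside the relevant triples the value 1 keeps the choice function total and positive. *)
    by exists 1%N; split => //; rewrite (negPf nok).
  move=> /and4P[/= ir jr ij d0].
  have ri : root (map_poly intr P) rs`_i by apply: rsP; exact: mem_nth.
  have rj : root (map_poly intr P) rs`_j by apply: rsP; exact: mem_nth.
  have [|N /andP[N0 hN] hy] := hA rs`_i rs`_j d ri rj d0; last by exists N.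
  rewrite -(inj_eq (fmorph_inj vK)) !rmorphXn; apply: nondeg => //.
  - rewrite -(fmorph_root vK) -map_poly_comp in ri.
    by rewrite (eq_map_poly (rmorph_int vK)) in ri.
  - rewrite -(fmorph_root vK) -map_poly_comp in rj.
    by rewrite (eq_map_poly (rmorph_int vK)) in rj.
  - by rewrite (inj_eq (fmorph_inj vK)) nth_uniq.
pose E L := (\prod_(i < r) \prod_(j < r | i != j :> nat) \prod_(d < L | 0 < d)
  N (i : nat, j : nat, d : nat))%N.
exists (r * r * A)%N, E; split.
  move=> L; apply/andP; split.
    apply: prodn_gt0 => i; apply: prodn_cond_gt0 => j _; apply: prodn_cond_gt0 => d _.
    by have [] := hN (i : nat, j : nat, d : nat).
  have bnd (I : finType) (Q : pred I) (F : I -> nat) a :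
      (forall i, Q i -> F i <= 2 ^ a)%N -> (\prod_(i | Q i) F i <= 2 ^ (#|I| * a))%N.
    move=> hF; apply: (@leq_trans (\prod_(i | Q i) 2 ^ a)%N).
      by apply: leq_prod.
    rewrite prod_nat_const -expnM leq_exp2l // mulnC leq_mul2r.
    by rewrite max_card orbT.
  apply: (@leq_trans (2 ^ (r * (r * (L * (A * L)))))); last first.
    by rewrite leq_exp2l //; nia.
  rewrite -[X in (2 ^ (X * _))%N]card_ord; apply: (bnd) => i _.
  rewrite -[X in (2 ^ (X * _))%N]card_ord; apply: (bnd) => j ij.
  rewrite -[X in (2 ^ (X * _))%N]card_ord; apply: (bnd) => d d0.
  have [_ h _] := hN (i : nat, j : nat, d : nat).
  apply: leq_trans (h _) _; first by rewrite /ok /= !ltn_ord ij d0.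
  by rewrite leq_exp2l // leq_mul2l (ltnW (ltn_ord d)) orbT.
move=> p L i j d p_pr pE ir jr ij /andP[d0 dL].
have [_ _ [|y yi e]] := hN (i, j, d); first by rewrite /ok /= ir jr ij d0.
apply: (regular_dvd p_pr yi e); apply: contra pE => h; apply: dvdn_trans h _.
rewrite /E (bigD1 (Ordinal ir)) //= (bigD1 (Ordinal jr)) //= (bigD1 (Ordinal dL)) //=.
by rewrite -!mulnA dvdn_mulr.
Qed.

Lemma few_multiples : exists (p0 r A : nat) (E : nat -> nat),
  (forall L, (0 < E L <= 2 ^ (A * L ^ 2))%N) /\
  (forall p L, prime p -> (p0 < p)%N -> ~~ (p %| E L)%N ->
    forall s L', (L' <= L)%N ->
    (count (fun m => p %| absz (u (p * m)%N))%N (iota s L') ^ (2 ^ r)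
      <= (4 * L') ^ (2 ^ r).-1)%N).
Proof.
have [rs [k [c [urs rsP hu [i1 i1r ci1]]]]] := exp_poly_form.
have [A [E [hE hreg]]] := pow_sub_multiples urs rsP.
have [D D0 hD] := common_denominator (size rs) k.+1 c.
pose b i := D%:R * c i 0%N.
have bi1 : b i1 != 0.
  by rewrite mulf_neq0 //; case: (D) D0.
have [n n0 hn] := alg_num_denominator (b i1)^-1.
(* Primes above [k] divide the binomials ['C(p * m, j)] with [0 < j <= k]; those above [|P_0|] make
   the roots regular; those above [n] make [n] regular. *)
exists (k + absz (P`_0)%R + n)%N, (size rs), A, E; split => // p L p_pr hp pE s L' LL'.
have small x : (0 < x <= k + absz (P`_0)%R + n)%N -> ~~ (p %| x)%N.
  by move=> /andP[x0 hx]; rewrite gtnNdvd // (leq_ltn_trans hx).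
rewrite leqNgt; apply/negP => hcount.
apply: (@modp0_1 K p K0 p_pr).
apply: (@regular_nat K p p_pr n); first by apply: small; rewrite n0 leq_addl.
  exact: (aint_nat _ 1).
have rai i : (i < size rs)%N -> aint rs`_i.
  by move=> ir; apply: (aint_root P_mon); apply: rsP; exact: mem_nth.
suff h : modp0 p (b i1).
  rewrite mulr1; have -> : n%:R = (n%:R * (b i1)^-1) * b i1 by rewrite mulfVK.
  exact: modp0M.
apply: (few_zeros (r := size rs) (gam := fun i => rs`_i ^+ p) _ _ _ _ _ hcount) => //.
- by move=> i ir; apply: aintX; exact: rai.
- by move=> i ir; apply: hD.
- move=> i ir; apply: regularX; first exact: rai.
  have [|y yi e] := @root_dvd_const_coef K P rs`_i P_mon; first by apply: rsP; exact: mem_nth.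
  apply: (regular_dvd p_pr yi e); apply: small.
  by rewrite absz_gt0 P0 -addnA addnCA leq_addr.
(* By Frobenius, the difference of the [d]-th powers of [gam i] and [gam j] is congruent to the
   [p]-th power of [rs]_i ^+ d - rs[_j ^+ d], and inherits its regularity. *)
- move=> i j d ir jr ij /andP[d0 dL'] y hy h.
  have aX l : (l < size rs)%N -> aint (rs`_l ^+ d) by move=> lr; apply: aintX; exact: rai.
  apply: (@regularX _ _ (rs`_i ^+ d - rs`_j ^+ d) p) => //.
  + by apply: aintD; [exact: aX | apply: aintN; exact: aX].
  + by apply: (hreg p L) => //; rewrite d0 (leq_trans dL').
  have := frobenius_modp0 p_pr (aX i ir) (aX j jr).
  move/(modp0M hy); rewrite mulrC => /modp0D/(_ h).
  by rewrite -!exprM ![(p * d)%N]mulnC mulrBl subrK.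
move=> m hm.
have -> : \sum_(i < size rs) b i * (rs`_i ^+ p) ^+ m =
    D%:R * (u (p * m)%N)%:~R - \sum_(i < size rs) rs`_i ^+ (p * m) *
      \sum_(j < k) (D%:R * c i j.+1) * 'C(p * m, j.+1)%:R.
  rewrite hu mulr_sumr -sumrB; apply: eq_bigr => i _.
  rewrite big_ord_recl bin0 mulr1 -exprM mulrCA -mulrBr [D%:R * (_ + _)]mulrDr.
  rewrite [X in _ + X - _](_ : _ = \sum_(j < k) (D%:R * c i j.+1) * 'C(p * m, j.+1)%:R).
    by rewrite addrK mulrC.
  by rewrite mulr_sumr; apply: eq_bigr => j _; rewrite mulrA.
apply: modp0D; first by apply: modp0M; [exact: aint_nat | apply: modp0_dvd; rewrite dvdzE].
apply/modp0N/modp0_sum => i _; apply: modp0M; first by apply: aintX; exact: rai.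
apply: modp0_sum => j _; apply: modp0M; first exact: (hD i j.+1 (ltn_ord i) (ltn_ord j)).
apply: modp0_dvdn; apply: prime_dvd_bin_multiple => //=.
by apply: leq_ltn_trans hp; rewrite -addnA (leq_trans (ltn_ord j)) // leq_addr.
Qed.
End KeyProposition.

Local Open Scope classical_set_scope.

(** * Densities over the reals *)

Section RealDensity.
Variables (R : realType) (A : pred nat).
Let c N : nat := count A (iota 1 N).
Let a N : R := (c N)%:R / N%:R.

Let c_le N : (c N <= N)%N.
Proof. by rewrite /c (leq_trans (count_size _ _)) // size_iota. Qed.

(** Replacing the denominator [t = truncn x] by [x] changes the quotient by at most [1 / x], as
    [c t <= t] and [x - t < 1]. *)
Lemma has_density_seq (d : R) : (a @ \oo --> d) -> has_density A d.
Proof.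
move=> /cvgrPdist_le ha; apply/cvgrPdist_le => eps e0.
have e2 : 0 < eps / 2 by rewrite divr_gt0.
have [N _ hN] := ha _ e2.
near=> x.
have x0 : 0 < x by near: x; apply: nbhs_pinfty_gt; exact: num_real.
have xe : 2 / eps <= x by near: x; apply: nbhs_pinfty_ge; exact: num_real.
have xN : N.+1%:R <= x by near: x; apply: nbhs_pinfty_ge; exact: num_real.
have /andP[t1 t2] := truncn_itv (ltW x0).
set t := Num.truncn x in t1 t2 *.
have Nt : (N < t)%N by rewrite /t -ltnS -(ltr_nat R); apply: le_lt_trans t2.
have t0 : 0 < t%:R :> R by rewrite ltr0n; apply: leq_trans Nt.
have := hN t (ltnW Nt); rewrite /a -/(c t) => h.
have ct : (c t)%:R <= t%:R :> R by rewrite ler_nat c_le.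
have -> : d - (c t)%:R / x = (d - (c t)%:R / t%:R) + (c t)%:R / t%:R * ((x - t%:R) / x).
  by field; rewrite !gt_eqF.
apply: le_trans (ler_normD _ _) _; rewrite [leRHS](splitr eps); apply: lerD => //.
rewrite ger0_norm; last first.
  by rewrite mulr_ge0 // divr_ge0 // ?subr_ge0 // ltW.
apply: (@le_trans _ _ (1 * (x^-1))).
  apply: ler_pM; rewrite ?divr_ge0 ?subr_ge0 ?(ltW x0) //.
    by rewrite ler_pdivrMr // mul1r.
  rewrite -[leRHS]mul1r ler_wpM2r ?invr_ge0 ?(ltW x0) //.
  by rewrite -natr1 in t2; lra.
rewrite mul1r -[eps / 2]invrK lef_pV2 ?posrE ?invr_gt0 //.
Unshelve. all: end_near.
Qed.

(** The ratio [w / T] is within [1 / M] of all late terms of [a], which is the Cauchy criterion. *)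
Lemma density_exists :
  (forall M, (0 < M)%N -> exists T w X : nat, (0 < T)%N /\ forall N, (X <= N)%N ->
    (M * (T * c N) <= M * (w * N) + T * N)%N /\ (M * (w * N) <= M * (T * c N) + T * N)%N) ->
  exists d : R, a @ \oo --> d.
Proof.
move=> h; suff : cvg (a @ \oo) by move=> ?; exists (lim (a @ \oo)).
apply: cauchy_cvg; apply: cauchy_exP => eps e0.
have [M hM] : exists M : nat, eps^-1 < M.+1%:R.
  by exists (Num.truncn eps^-1); apply: truncnS_gt.
have [T [w [X [T0 hX]]]] := h M.+1 isT.
exists (w%:R / T%:R); exists X.+1 => // N /= XN.
have N0 : 0 < N%:R :> R by rewrite ltr0n; apply: leq_trans XN.
have T0' : 0 < T%:R :> R by rewrite ltr0n.
have M0 : 0 < M.+1%:R :> R by rewrite ltr0n.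
have [h1 h2] := hX N (ltnW XN).
rewrite -ball_normE /ball_ /=; apply: (@le_lt_trans _ _ M.+1%:R^-1); last first.
  by rewrite -[eps]invrK ltf_pV2 ?posrE ?invr_gt0.
have -> : w%:R / T%:R - a N = (M.+1%:R * (w%:R * N%:R) - M.+1%:R * (T%:R * (c N)%:R)) /
    (M.+1%:R * (T%:R * N%:R)).
  by rewrite /a; field; rewrite !gt_eqF.
have p0 : 0 < M.+1%:R * (T%:R * N%:R) :> R by rewrite !mulr_gt0.
rewrite normrM normfV (gtr0_norm p0) ler_pdivrMr // mulKf ?gt_eqF //.
move: h1 h2; rewrite -!(ler_nat R) !(natrD, natrM) => h1 h2.
by rewrite ler_norml; apply/andP; split; lra.
Qed.

Lemma density_pos (d : R) M X : (0 < M)%N -> (forall N, (X <= N)%N -> (N <= M * c N)%N) ->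
  a @ \oo --> d -> 0 < d.
Proof.
move=> M0 h ha; apply: (@lt_le_trans _ _ (M%:R^-1)); first by rewrite invr_gt0 ltr0n.
apply: (cvgr_to_ge ha); exists X.+1 => // N /= XN.
have N0 : (0 < N)%N by apply: leq_trans XN.
rewrite /a ler_pdivlMr ?ltr0n // mulrC ler_pdivrMr ?ltr0n // -natrM ler_nat mulnC.
by apply: h; exact: ltnW.
Qed.

Lemma finite_density0 B : (forall n, A n -> (n <= B)%N) -> has_density A (0 : R).
Proof.
move=> hB; have cB N : (c N <= B)%N.
  have [NB|NB] := leqP N B; first exact: leq_trans (c_le N) NB.
  rewrite /c -(subnKC (ltnW NB)) iotaD count_cat [X in (_ + X)%N](_ : _ = 0%N).
    by rewrite addn0; exact: c_le.
  apply/eqP; rewrite -leqn0 leqNgt -has_count; apply/hasPn => n.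
  rewrite mem_iota => /andP[h _]; apply/negP => /hB; lia.
apply: has_density_seq; apply/cvgrPdist_le => eps e0.
exists (Num.truncn (B%:R / eps)).+1 => // N /= hN.
have N0 : 0 < N%:R :> R by rewrite ltr0n; apply: leq_trans hN.
rewrite sub0r normrN /a ger0_norm ?divr_ge0 ?ler0n // ler_pdivrMr //.
apply: (@le_trans _ _ B%:R); first by rewrite ler_nat.
rewrite mulrC -ler_pdivrMr //; apply: ltW.
by apply: (lt_le_trans (truncnS_gt _)); rewrite ler_nat.
Qed.
End RealDensity.

Local Close Scope classical_set_scope.

(** * The theorem *)

Section RecurrencePolynomial.
Variables (F : comNzRingType) (k : nat) (c : nat -> F).

Definition rec_poly : {poly F} := 'X^k - \sum_(1 <= i < k.+1) c i *: 'X^(k - i).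

Let sum_small : (size (\sum_(1 <= i < k.+1) c i *: 'X^(k - i))%R < size ('X^k : {poly F})%R)%N.
Proof.
rewrite size_polyXn ltnS big_nat; apply: (big_ind (fun p : {poly F} => size p <= k)%N).
- by rewrite size_poly0.
- by move=> p q hp hq; rewrite (leq_trans (size_polyD _ _)) // geq_max hp.
move=> i /andP[i1 ik]; apply: leq_trans (size_scale_leq _ _) _.
by rewrite size_polyXn; lia.
Qed.

Lemma rec_poly_monic : rec_poly \is monic.
Proof. by rewrite monicE lead_coefDl ?size_polyN // lead_coefXn. Qed.

Lemma size_rec_poly : size rec_poly = k.+1.
Proof. by rewrite size_polyDl ?size_polyN // size_polyXn. Qed.

Lemma rec_poly_coef0 : (0 < k)%N -> rec_poly`_0 = - c k.
Proof.
move=> k0; rewrite coefB coefXn eq_sym -leqn0 leqNgt k0 sub0r; congr (- _).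
rewrite coef_sum big_nat_recr //= coefZ coefXn subnn eqxx mulr1 big_nat big1 ?add0r //.
move=> i /andP[i1 ik]; rewrite coefZ coefXn eq_sym subn_eq0 leqNgt ik mulr0 //.
Qed.
End RecurrencePolynomial.

Lemma linear_recurrenceP (F : fieldType) (v : nat -> F) :
  is_linear_recurrence v <->
  exists2 Q : {poly F}, Q \is monic & forall n, act Q v n = 0.
Proof.
split=> [[m [c h]]|[Q Q_mon hQ]].
  exists (rec_poly m c); first exact: rec_poly_monic.
  by move=> n; rewrite act_recurrence h subrr.
have sQ : size Q = (size Q).-1.+1 by rewrite prednK // size_poly_gt0 monic_neq0.
set m := (size Q).-1 in sQ; exists m, (fun i => - Q`_(m - i)) => n.
have := hQ n; rewrite /act sQ big_ord_recr /=.
have -> : Q`_m = 1 by move/monicP: Q_mon.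
rewrite mul1r addrC => /eqP; rewrite addr_eq0 => /eqP ->; rewrite -sumrN.
rewrite big_add1 /= big_mkord (reindex_inj rev_ord_inj) /=.
apply: eq_bigr => i _; have hi := ltn_ord i.
have -> : (n + m - i.+1 = n + (m - i.+1))%N by lia.
by rewrite mulNr.
Qed.

(* Pigeonhole on the [k]-tuples of consecutive residues. *)
Lemma int_lin_rec_periodic (u : nat -> int) (k : nat) (a : nat -> int) (q : nat) :
  (0 < q)%N -> int_lin_rec u k a ->
  exists T n1, (0 < T)%N /\ forall n, (n1 <= n)%N -> (q%:Z %| u (n + T)%N - u n)%Z.
Proof.
case: q => // q _ hu.
pose res (x : int) : 'I_q.+1 := inord (absz (x %% q.+1)%Z).
have resE x y : res x = res y -> (q.+1%:Z %| x - y)%Z.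
  have lt (x' : int) : (absz (x' %% q.+1)%Z < q.+1)%N.
    by rewrite -ltz_nat gez0_abs ?modz_ge0 // ltz_pmod.
  move=> /(congr1 val); rewrite /= !inordK // => h.
  by rewrite -eqz_mod_dvd -[(x %% _)%Z]gez0_abs ?modz_ge0 // h gez0_abs ?modz_ge0.
pose S := {ffun 'I_k -> 'I_q.+1}.
pose st (n : 'I_#|S|.+1) : S := [ffun i : 'I_k => res (u (n + i)%N)].
have [i [j [ij hij]]] : exists i j : 'I_#|S|.+1, (i < j)%N /\ st i = st j.
  have /injectivePn[i [j ij hij]] : ~~ injectiveb st.
    by apply/negP => /injectiveP/leq_card; rewrite card_ord ltnn.
  have [lt|gt|/val_inj e] := ltngtP i j; [by exists i, j | by exists j, i |].
  by rewrite e eqxx in ij.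
have key n : (q.+1%:Z %| u (j + n)%N - u (i + n)%N)%Z.
  elim/ltn_ind: n => n IH; have [nk|kn] := ltnP n k.
    by apply: resE; have /ffunP/(_ (Ordinal nk)) := esym hij; rewrite !ffunE.
  rewrite !hu; [|lia|lia]; rewrite -sumrB big_nat.
  apply: (big_ind (fun x : int => (q.+1%:Z %| x)%Z)) => //; first exact: rpredD.
  move=> l /andP[l1 lk]; rewrite -mulrBr dvdz_mull // -!addnBA; [|lia|lia].
  by apply: IH; lia.
exists (j - i)%N, i; split; first by rewrite subn_gt0.
move=> n hn; have := key (n - i)%N.
have -> : (j + (n - i) = n + (j - i))%N by lia.
by rewrite subnKC.
Qed.

Section QuotientLinearRecurrence.
Variables (C : numFieldType) (P : {poly int}) (u : nat -> int).
Hypothesis P_mon : P \is monic.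
Hypothesis Pu : forall n, act P u n = 0.

(** The annihilator [(X P)^N] of [v] is monic over the integers, so integrality of [D * v n]
    propagates from the first [m] terms, where [D = m!] ensures it. Hence [n] divides [D * u n], and
    coprimality leaves [n] dividing [D]. *)
Lemma linear_recurrence_quotient_bounded :
  is_linear_recurrence (fun n : nat => (u n.+1)%:~R / n.+1%:R : C) ->
  exists B : nat, forall n, (0 < n)%N && coprime n (absz (u n)) -> (n <= B)%N.
Proof.
set v := fun n : nat => _; move=> /linear_recurrenceP[Q Q_mon hQ].
have C0 n : n.+1%:R != 0 :> C by rewrite pnatr_eq0.
have hP n : act (map_poly intr P) (fun m => m.+1%:R * v m) n = 0.
  have e : (fun m => m.+1%:R * v m) =1 (fun m => (u m.+1)%:~R).
    by move=> m; rewrite /v mulrC divfK.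
  rewrite (eq_act _ _ e) (act_map intr P (fun m => u m.+1)).
  have -> : act P (fun m => u m.+1) n = act P u n.+1.
    by apply: eq_bigr => i _; rewrite addSn.
  by rewrite Pu rmorph0.
have [N hN] := index_quotient_annihilator C0 hP (monic_neq0 Q_mon) hQ.
pose T : {poly int} := ('X * P) ^+ N.
have T_mon : T \is monic by rewrite monic_exp // monicMl // monicX.
have hT n : act (map_poly intr T) v n = 0.
  by rewrite -(hN n) rmorphXn rmorphM /= map_polyX.
have sT : size T = (size T).-1.+1 by rewrite prednK // size_poly_gt0 monic_neq0.
set m := (size T).-1 in sT.
have T1 : T`_m = 1 by move/monicP: T_mon.
pose D := (\prod_(i < m) i.+1)%N.
have D0 : (0 < D)%N by apply: prodn_gt0.
have int_v n : exists y : int, D%:R * v n = y%:~R.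
  elim/ltn_ind: n => n IH; have [nm|mn] := ltnP n m.
    rewrite /v /D (bigD1 (Ordinal nm)) //= natrM; set E := (\prod_(_ < _ | _) _)%N.
    exists (E%:Z * u n.+1); rewrite intrM -pmulrn.
    by rewrite mulrC mulrA divfK // mulrC.
  have := hT (n - m)%N; rewrite (act_widen (m := m.+1)); last by rewrite -sT size_poly.
  rewrite big_ord_recr /= coef_map /= T1 mul1r subnK // addrC => /eqP.
  rewrite addr_eq0 => /eqP ->.
  have /(@choice _ _) [f hf] : forall i : 'I_m, exists y : int, D%:R * v (n - m + i)%N = y%:~R.
    by move=> i; apply: IH; have := ltn_ord i; lia.
  exists (- \sum_(i < m) T`_i * f i); rewrite mulrN mulr_sumr rmorphN rmorph_sum.
  by congr (- _); apply: eq_bigr => i _; rewrite coef_map mulrCA hf rmorphM.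
exists D => n /andP[n0 cop]; have [y] := int_v n.-1; rewrite /v prednK // => hy.
have e : D%:Z * u n = y * n%:Z.
  apply: (@intr_inj C); rewrite !intrM -!pmulrn -hy mulrA mulfVK //.
  by rewrite pnatr_eq0 -lt0n.
apply: dvdn_leq => //; rewrite -(Gauss_dvdl _ cop).
have : (n%:Z %| D%:Z * u n)%Z by rewrite e dvdz_mull.
by rewrite dvdzE abszM /=.
Qed.
End QuotientLinearRecurrence.

Theorem theorem1p1 (R : realType) (u : nat -> int) (k : nat) (a : nat -> int) :
  (1 <= k)%N ->
  a k != 0 ->
  int_lin_rec u k a ->
  (exists n : nat, u n != 0) ->
  nondegenerate_lrs (complex.complex R) k a ->
  let A := fun n : nat => (0 < n)%N && coprime n `|u n|%N in
  exists d : R, has_density A d /\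
    (~ is_linear_recurrence (fun n : nat => ((u n.+1)%:~R / n.+1%:R : (complex.complex R))) -> 0 < d) /\
    (is_linear_recurrence (fun n : nat => ((u n.+1)%:~R / n.+1%:R : (complex.complex R))) ->
       exists B : nat, forall n : nat, A n -> (n <= B)%N).
Proof.
move=> k1 ak hu _ nondeg A.
pose P := rec_poly k a.
have P_mon : P \is monic by exact: rec_poly_monic.
have sP : size P = k.+1 by exact: size_rec_poly.
have P0 : P`_0 != 0 by rewrite rec_poly_coef0 // oppr_eq0.
have Pu n : act P u n = 0.
  by rewrite act_recurrence hu ?subrr // leq_addl.
have [lin|nlin] := pselect (is_linear_recurrence
    (fun n : nat => ((u n.+1)%:~R / n.+1%:R : (complex.complex R)))).
  have [B hB] := linear_recurrence_quotient_bounded P_mon Pu lin.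
  exists 0; split; first exact: finite_density0 hB.
  by split => // _; exists B.
pose C : numClosedFieldType := complex.complex R.
have PC : map_poly intr P = Defs.char_poly C k a.
  rewrite /P /rec_poly /Defs.char_poly rmorphB /= map_polyXn rmorph_sum.
  by congr (_ - _); apply: eq_bigr => i _; rewrite /= map_polyZ /= map_polyXn.
have root0 (x : C) : root (map_poly intr P) x -> x != 0.
  move=> h; apply: contraNneq P0 => x0; move: h.
  by rewrite x0 /root horner_coef0 coef_map /= intr_eq0.
(* As [a k] is nonzero, 0 is not a root, so the condition on ratios can be restated for powers. *)
have nd (x y : C) : root (map_poly intr P) x -> root (map_poly intr P) y -> x != y ->
    forall d, (0 < d)%N -> x ^+ d != y ^+ d.
  move=> rx ry xy d d0; have y0 := root0 y ry; rewrite PC in rx ry.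
  have := nondeg x y rx ry xy d d0; apply: contra_neq => e.
  by rewrite expr_div_n e divff // expf_neq0.
have nl : ~ exists2 Q : {poly C}, Q \is monic &
    forall n, act Q (fun m => (u m.+1)%:~R / m.+1%:R) n = 0.
  by move/linear_recurrenceP.
have sP1 : (1 < size P)%N by rewrite sP ltnS.
have [p0 [r [A0 [E [hE few]]]]] := few_multiples P_mon P0 sP1 Pu nd nl.
pose z p : pred nat := fun m => (p %| absz (u (p * m)))%N.
have e0 : (0 < 2 ^ r)%N by rewrite expn_gt0.
have [c [S0 htail]] := tail_bound (z := z) e0 hE few.
have zE p n : (p %| n)%N -> z p (n %/ p)%N = (p %| absz (u n))%N.
  by move=> pn; rewrite /z mulnC divnK.
have A_avoid Y n : (0 < n)%N -> A n -> avoid z Y n.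
  move=> n0 /andP[_ cop]; apply/allP => p _; apply/implyP => p_pr; apply/negP => /andP[pn].
  rewrite zE // => pu; have : (p %| gcdn n (absz (u n)))%N by rewrite dvdn_gcd pn.
  by rewrite (eqP cop) dvdn1 => /eqP p1; move: p_pr; rewrite p1.
have avoid_A Y n : (0 < n)%N -> avoid z Y n -> ~~ tail z Y n -> A n.
  move=> n0 hav ht; rewrite /A n0 /=; apply: contraT => ncop.
  pose g := gcdn n (absz (u n)); have g0 : (0 < g)%N by rewrite gcdn_gt0 n0.
  have g1 : (1 < g)%N by rewrite ltn_neqAle eq_sym ncop.
  have p_pr := pdiv_prime g1; set p := pdiv g in p_pr.
  have : (p %| g)%N := pdiv_dvd g; rewrite dvdn_gcd => /andP[pn pu].
  have zp : z p (n %/ p)%N by rewrite zE.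
  have [pY|Yp] := ltnP p Y.
    have /allP/(_ p) := hav; rewrite mem_iota add0n pY => /(_ isT).
    by rewrite p_pr pn zp.
  move: ht; rewrite -all_predC => /allP/(_ p).
  rewrite mem_iota prime_gt0 // add1n ltnS dvdn_leq // => /(_ isT) /=.
  by rewrite p_pr Yp pn zp.
have per Y : exists T n1, (0 < T)%N /\ forall n, (n1 <= n)%N -> avoid z Y (n + T) = avoid z Y n.
  have [T [n1 [T0 hT]]] := int_lin_rec_periodic (primorial_gt0 Y) hu.
  (* A multiple of [T] preserves [u n] modulo each [p < Y], and a multiple of [primorial Y]
     preserves the condition [p %| n]. *)
  exists (T * primorial Y)%N, n1; split; first by rewrite muln_gt0 T0 primorial_gt0.
  move=> n hn; apply: eq_in_all => p; rewrite mem_iota add0n => /andP[_ pY].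
  case p_pr: (prime p) => //=.
  have pQ : (p %| primorial Y)%N.
    rewrite /primorial big_mkcond (bigD1_seq p) ?mem_index_iota ?iota_uniq //=.
    by rewrite p_pr dvdn_mulr.
  have pT : (p %| n + T * primorial Y)%N = (p %| n)%N by rewrite dvdn_addl // dvdn_mull.
  rewrite pT; case pn: (p %| n)%N => //=; rewrite !zE ?pT //.
  have : (p%:Z %| u (n + T * primorial Y)%N - u n)%Z.
    elim: (primorial Y) => [|q IH]; first by rewrite muln0 addn0 subrr dvdz0.
    rewrite -(subrKA (u (n + T * q)%N)) rpredD //.
    apply: (@dvdz_trans (primorial Y)%:Z) => //.
    by rewrite mulnSr addnA; apply: hT; apply: leq_trans hn (leq_addr _ _).
  move=> h; have : (p%:Z %| u (n + T * primorial Y)%N)%Z = (p%:Z %| u n)%Z.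
    by rewrite -[X in (_ %| X)%Z](subrK (u n)) rpredDl.
  by rewrite !dvdzE /= => ->.
have [d hd] := @density_exists R A (count_cauchy htail A_avoid avoid_A per).
exists d; split; first exact: has_density_seq.
split=> // _.
have [M [X [M0 hM]]] := count_lower_bound htail A_avoid avoid_A.
exact: density_pos M0 hM hd.
Qed.
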